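(* Let $l>0$ be fixed. Let $a_1,\dots,a_8\ge 0$ and $\widetilde a_1,\dots,\widetilde a_8\ge 0$ be real numbers, and let $A$, $\widetilde A$ and $\widetilde A^*$ be the $4\times 8$ matrices defined in the context. Suppose that $\operatorname{rank} A=\operatorname{rank}\widetilde A=4$. Consider the eigenvalue problem $$y^{(4)}=s^2y \text{ on } [0,l],\quad -a_1y(0)+a_4y'''(0)=0,\quad -a_2y'(0)+a_3y''(0)=0,\quad a_5y(l)+a_8y'''(l)=0,\quad a_6y'(l)+a_7y''(l)=0,$$ with eigenvalues $\{s_i\}$, and the eigenvalue problem $$y^{(4)}=s^2y \text{ on } [0,l],\quad -\widetilde a_1y(0)+\widetilde a_4y'''(0)=0,\quad -\widetilde a_2y'(0)+\widetilde a_3y''(0)=0,\quad \widetilde a_5y(l)+\widetilde a_8y'''(l)=0,\quad \widetilde a_6y'(l)+\widetilde a_7y''(l)=0,$$ with eigenvalues $\{\widetilde s_i\}$. If the eigenvalues $\{s_i\}$ and $\{\widetilde s_i\}$ are identical, counted with their multiplicities, then either the classes of linearly equivalent matrices of $A$ and of $\widetilde A$ coincide, or the classes of linearly equivalent matrices of $A$ and of $\widetilde A^*$ coincide.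
   Context: The matrices are $$A=\begin{pmatrix} a_1&0&0&a_4&0&0&0&0\\ 0&a_2&a_3&0&0&0&0&0\\ 0&0&0&0&a_5&0&0&a_8\\ 0&0&0&0&0&a_6&a_7&0\end{pmatrix},\qquad \widetilde A=\begin{pmatrix} \widetilde a_1&0&0&\widetilde a_4&0&0&0&0\\ 0&\widetilde a_2&\widetilde a_3&0&0&0&0&0\\ 0&0&0&0&\widetilde a_5&0&0&\widetilde a_8\\ 0&0&0&0&0&\widetilde a_6&\widetilde a_7&0\end{pmatrix},$$ $$\widetilde A^*=\begin{pmatrix} \widetilde a_5&0&0&\widetilde a_8&0&0&0&0\\ 0&\widetilde a_6&\widetilde a_7&0&0&0&0&0\\ 0&0&0&0&\widetilde a_1&0&0&\widetilde a_4\\ 0&0&0&0&0&\widetilde a_2&\widetilde a_3&0\end{pmatrix}.$$ Two $4\times 8$ matrices $B,B'$ are linearly equivalent if $B'=SB$ for some invertible $4\times4$ matrix $S$ (i.e. they define the same system of linear boundary conditions). Eigenvalues: write $U_1(y)=-a_1y(0)+a_4y'''(0)$, $U_2(y)=-a_2y'(0)+a_3y''(0)$, $U_3(y)=a_5y(l)+a_8y'''(l)$, $U_4(y)=a_6y'(l)+a_7y''(l)$. For $s\in\mathbb C$ let $y_1(\cdot,s),\dots,y_4(\cdot,s)$ be the solutions of $y^{(4)}=s^2y$ with $y_j^{(r-1)}(0,s)=\delta_{jr}$ for $j,r=1,2,3,4$ (derivatives in $x$). The eigenvalues of the first problem are the roots $s\in\mathbb C$ of the entire function $\Delta(s)=\det\big(U_i(y_j(\cdot,s))\big)_{i,j=1}^4$,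 and the multiplicity of an eigenvalue is its multiplicity as a root of $\Delta$. The eigenvalues of the second problem and their multiplicities are defined in the same way with $\widetilde a_i$ in place of $a_i$. *)

(* Defs.v *)
From HB Require Import structures.
From mathcomp Require Import all_boot all_order all_algebra.
From mathcomp Require Import all_classical all_reals all_analysis.
From mathcomp Require Import complex.

Set Implicit Arguments.
Unset Strict Implicit.
Unset Printing Implicit Defensive.

Import Order.TTheory GRing.Theory Num.Theory.
Import numFieldNormedType.Exports.

Local Open Scope classical_set_scope.
Local Open Scope ring_scope.
Local Open Scope complex_scope.

Section Defs.
Variable R : realType.

(* The coefficients a_1, ..., a_8 are given by [a : nat -> R]; the values of
   [a] outside 1, ..., 8 are never used. *)

Definition rows_mx (rows : seq (seq R)) : 'M[R]_(4, 8) :=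
  \matrix_(i < 4, j < 8) nth 0 (nth [::] rows i) j.

Definition bc_mx (a : nat -> R) : 'M[R]_(4, 8) := rows_mx
  [:: [:: a 1%N; 0; 0; a 4%N; 0; 0; 0; 0];
      [:: 0; a 2%N; a 3%N; 0; 0; 0; 0; 0];
      [:: 0; 0; 0; 0; a 5%N; 0; 0; a 8%N];
      [:: 0; 0; 0; 0; 0; a 6%N; a 7%N; 0]].

Definition bc_mx_star (a : nat -> R) : 'M[R]_(4, 8) := rows_mx
  [:: [:: a 5%N; 0; 0; a 8%N; 0; 0; 0; 0];
      [:: 0; a 6%N; a 7%N; 0; 0; 0; 0; 0];
      [:: 0; 0; 0; 0; a 1%N; 0; 0; a 4%N];
      [:: 0; 0; 0; 0; 0; a 2%N; a 3%N; 0]].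

Definition lin_equiv (B B' : 'M[R]_(4, 8)) : Prop :=
  exists2 S : 'M[R]_4, S \in unitmx & B' = S *m B.

Definition lin_class (B : 'M[R]_(4, 8)) : set 'M[R]_(4, 8) :=
  [set B' | lin_equiv B B'].

(* R[i] is not a normed space over R in the library, so complex-valued
   functions of a real variable are differentiated componentwise. *)
Definition cderivable (f : R -> R[i]) (x : R) : Prop :=
  derivable (fun t => complex.Re (f t)) x 1 /\
  derivable (fun t => complex.Im (f t)) x 1.

Definition cderive1 (f : R -> R[i]) (x : R) : R[i] :=
  @Complex R (derive1 (fun t => complex.Re (f t)) x)
             (derive1 (fun t => complex.Im (f t)) x).

Definition cderiven (n : nat) (f : R -> R[i]) : R -> R[i] :=
  iter n cderive1 f.

(* Since the equation is linear with constant coefficients, its solutions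
   extend uniquely from [0, l] to the real line, where they are taken here. *)
Definition ode_solution (s : R[i]) (f : R -> R[i]) : Prop :=
  (forall (k : nat) (x : R), (k < 4)%N -> cderivable (cderiven k f) x) /\
  (forall x : R, cderiven 4 f x = s ^+ 2 * f x).

Definition fundamental_system (s : R[i]) (f : 'I_4 -> R -> R[i]) : Prop :=
  forall j : 'I_4, ode_solution s (f j) /\
    forall k : 'I_4, cderiven k (f j) 0 = (j == k)%:R.

Definition bc_form (l : R) (a : nat -> R) (i : 'I_4) (f : R -> R[i]) : R[i] :=
  nth 0
    [:: - (a 1%N)%:C * f 0 + (a 4%N)%:C * cderiven 3 f 0;
        - (a 2%N)%:C * cderiven 1 f 0 + (a 3%N)%:C * cderiven 2 f 0;
        (a 5%N)%:C * f l + (a 8%N)%:C * cderiven 3 f l;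
        (a 6%N)%:C * cderiven 1 f l + (a 7%N)%:C * cderiven 2 f l] i.

Definition char_det (l : R) (a : nat -> R) (y : R[i] -> 'I_4 -> R -> R[i])
    (s : R[i]) : R[i] :=
  \det (\matrix_(i < 4, j < 4) bc_form l a i (y s j)).

(* [R[i]^o] makes R[i] a normed space over itself, so that this is
   complex differentiability. *)
Definition entire (g : R[i] -> R[i]) : Prop :=
  forall z : R[i], derivable (g : R[i]^o -> R[i]^o) z 1.

Definition root_mult (f : R[i] -> R[i]) (z : R[i]) (m : nat) : Prop :=
  exists g : R[i] -> R[i],
    [/\ entire g, forall w, f w = (w - z) ^+ m * g w & g z != 0].

Definition same_roots_with_mult (D D' : R[i] -> R[i]) : Prop :=
  forall s : R[i], (D s = 0 <-> D' s = 0) /\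
    (D s = 0 -> forall m : nat, root_mult D s m <-> root_mult D' s m).

End Defs.

(* Main.v *)
(* Expanding the characteristic determinant in the products of one coefficient
   from each boundary condition gives ten functions of s, with coefficients that
   are symmetric in the two ends of the interval. For s = z^2, z > 0, the
   determinant is, up to the factor 2 z^4,
     e(z) + (al(z) cos(zl) + be(z) sin(zl)) exp(zl) / 2 + O(z^8 exp(-zl))
   with polynomials e, al, be in z whose coefficients are the ten numbers above.
   It has arbitrarily large positive zeros, and at zeros common to two problems
   the polynomials al' be - al be', al' e - al e' and be' e - be e' are
   exponentially small, hence they vanish identically: no factorization theorem
   for entire functions is needed. These polynomial identities almost say that
   the ten coefficients of the two problems are proportional; the remaining
   ambiguity, a factor which is a power of s, is removed by comparing the
   multiplicities of s = 0. Finally the ten coefficients determine the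
   two binary quadratic forms (a1 x + a4 y)(a5 x + a8 y) and
   (a2 x + a3 y)(a6 x + a7 y), hence the conditions up to exchanging the ends in
   each form, and the coefficient CF forces the exchange to be simultaneous. *)

Require Import Defs.
From HB Require Import structures.
From mathcomp Require Import polyrcf.
From mathcomp Require Import all_boot all_order all_algebra.
From mathcomp Require Import all_classical all_reals all_analysis.
From mathcomp Require Import complex.
From mathcomp Require Import ring lra.

Import Order.TTheory GRing.Theory Num.Theory.
Import numFieldNormedType.Exports.

Local Open Scope ring_scope.
Local Open Scope complex_scope.

(** * Algebra of the boundary coefficients *)

Section CoefficientAlgebra.
Context {R : realFieldType}.
Implicit Types a ta : nat -> R.

(* (a1 x + a4 y) (a5 x + a8 y) = qA0 x^2 + qA1 xy + qA2 y^2 and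
   (a2 x + a3 y) (a6 x + a7 y) = qB0 x^2 + qB1 xy + qB2 y^2. *)
Definition qA0 a := a 1%N * a 5%N.
Definition qA1 a := a 1%N * a 8%N + a 4%N * a 5%N.
Definition qA2 a := a 4%N * a 8%N.
Definition qB0 a := a 2%N * a 6%N.
Definition qB1 a := a 2%N * a 7%N + a 3%N * a 6%N.
Definition qB2 a := a 3%N * a 7%N.

(* Coefficients of the characteristic function, see [charfun]. Letters name the
   conditions kept at the two ends: C = clamped (y = y' = 0), P = pinned
   (y = y'' = 0), S = sliding (y' = y''' = 0), F = free (y'' = y''' = 0); [cY] is
   the sum of the coefficients CF and PS. *)
Definition cCC a := qA0 a * qB0 a.
Definition cCP a := qA0 a * qB1 a.
Definition cPP a := qA0 a * qB2 a.
Definition cCS a := - (qA1 a * qB0 a).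
Definition cY a := - (qA1 a * qB1 a).
Definition cPF a := qA1 a * qB2 a.
Definition cSS a := - (qA2 a * qB0 a).
Definition cSF a := - (qA2 a * qB1 a).
Definition cFF a := qA2 a * qB2 a.
Definition cCF a :=
  - (a 1%N * a 2%N * a 7%N * a 8%N + a 3%N * a 4%N * a 5%N * a 6%N).

Definition wedge (p q : (nat -> R) -> R) a ta := p ta * q a - p a * q ta.

(* For the polynomials e, al, be with coefficients [ecoefs], [acoefs], [bcoefs]
   below, written with a prime for [ta], these are the coefficients of
   al' be - al be', al' e - al e' and be' e - be e'. *)
Definition Jcoefs a ta : seq R := [::
  0;
  - wedge cCC cCP a ta;
  - 2 * wedge cCC cPP a ta;
  - wedge cCC cCS a ta + 2 * wedge cPP cCP a ta;
  2 * wedge cCS cCP a ta;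
  - wedge cCC cPF a ta + 2 * wedge cY cCP a ta - wedge cCF cCP a ta
    - 2 * wedge cPP cCS a ta;
  - 2 * wedge cCC cSS a ta + 4 * wedge cY cPP a ta - 2 * wedge cCF cPP a ta;
  - wedge cCC cSF a ta + 2 * wedge cY cCS a ta - wedge cCF cCS a ta
    + 2 * wedge cSS cCP a ta + 2 * wedge cPP cPF a ta;
  2 * wedge cSF cCP a ta + 2 * wedge cCS cPF a ta;
  2 * wedge cY cPF a ta - wedge cCF cPF a ta - wedge cFF cCP a ta
    - 2 * wedge cSS cCS a ta - 2 * wedge cPP cSF a ta;
  4 * wedge cY cSS a ta - 2 * wedge cCF cSS a ta - 2 * wedge cFF cPP a ta;
  2 * wedge cY cSF a ta - wedge cCF cSF a ta - wedge cFF cCS a ta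
    + 2 * wedge cSS cPF a ta;
  2 * wedge cSF cPF a ta;
  - wedge cFF cPF a ta - 2 * wedge cSS cSF a ta;
  - 2 * wedge cFF cSS a ta;
  - wedge cFF cSF a ta].

Definition Wcoefs a ta : seq R := [::
  0;
  wedge cCC cCP a ta;
  0;
  - wedge cCC cCS a ta;
  - 2 * wedge cCC cY a ta;
  wedge cCF cCP a ta + wedge cCC cPF a ta;
  0;
  - wedge cCF cCS a ta - wedge cCC cSF a ta;
  - 2 * wedge cCF cY a ta;
  wedge cFF cCP a ta + wedge cCF cPF a ta;
  0;
  - wedge cFF cCS a ta - wedge cCF cSF a ta;
  - 2 * wedge cFF cY a ta;
  wedge cFF cPF a ta;
  0;
  - wedge cFF cSF a ta].

Definition Ucoefs a ta : seq R := [::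
  0;
  - wedge cCC cCP a ta;
  - 2 * wedge cCC cPP a ta;
  - wedge cCC cCS a ta;
  0;
  - wedge cCF cCP a ta - wedge cCC cPF a ta;
  - 2 * wedge cCF cPP a ta - 2 * wedge cCC cSS a ta;
  - wedge cCF cCS a ta - wedge cCC cSF a ta;
  0;
  - wedge cFF cCP a ta - wedge cCF cPF a ta;
  - 2 * wedge cFF cPP a ta - 2 * wedge cCF cSS a ta;
  - wedge cFF cCS a ta - wedge cCF cSF a ta;
  0;
  - wedge cFF cPF a ta;
  - 2 * wedge cFF cSS a ta;
  - wedge cFF cSF a ta].

(** * Proportionality of the ten coefficients *)

Definition proportional a ta (c : R) := forall p : (nat -> R) -> R,
  List.In p [:: cCC; cCP; cPP; cCS; cY; cPF; cSS; cSF; cFF; cCF] ->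
  p ta = c * p a.

Lemma proportionalP a ta c :
  cCC ta = c * cCC a -> cCP ta = c * cCP a -> cPP ta = c * cPP a ->
  cCS ta = c * cCS a -> cY ta = c * cY a -> cPF ta = c * cPF a ->
  cSS ta = c * cSS a -> cSF ta = c * cSF a -> cFF ta = c * cFF a ->
  cCF ta = c * cCF a -> proportional a ta c.
Proof.
by move=> *; move=> p /= [<-|[<-|[<-|[<-|[<-|[<-|[<-|[<-|[<-|[<-|]]]]]]]]]].
Qed.

Definition nondegenerate a := [/\ forall i : nat, (1 <= i <= 8)%N -> 0 <= a i,
  0 < a 1%N + a 4%N, 0 < a 2%N + a 3%N, 0 < a 5%N + a 8%N & 0 < a 6%N + a 7%N].

(** The four expressions are the coefficients of (x0 + x1 t + x2 t^2)(d + e t), and polynomials over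
    a field have no zero divisors. *)
Lemma conv_eq0 (x0 x1 x2 d e : R) : [|| x0 != 0, x1 != 0 | x2 != 0] ->
  x0 * d = 0 -> x1 * d + x0 * e = 0 -> x2 * d + x1 * e = 0 -> x2 * e = 0 ->
  d = 0 /\ e = 0.
Proof.
have [->|x0n] := eqVneq x0 0; last first.
  move=> _ /eqP; rewrite mulf_eq0 (negbTE x0n) /= => /eqP -> + _ _.
  by rewrite mulr0 add0r => /eqP; rewrite mulf_eq0 (negbTE x0n) /= => /eqP.
have [->|x1n] := eqVneq x1 0; last first.
  move=> _ _ /eqP; rewrite mul0r addr0 mulf_eq0 (negbTE x1n) /= => /eqP -> + _.
  by rewrite mulr0 add0r => /eqP; rewrite mulf_eq0 (negbTE x1n) /= => /eqP.
move=> /= x2n _ _ /eqP + /eqP.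
by rewrite mul0r addr0 !mulf_eq0 (negbTE x2n) /= => /eqP + /eqP.
Qed.

(** The ratio c of [cY] passes to [cCC], [cCF], [cFF] through the entries 4, 8, 12 of [Wcoefs]. If
    one of these three is nonzero, the other relations used are convolutions as in [conv_eq0];
    otherwise [Jcoefs] is solved successively. *)
Lemma proportional_Y a ta :
  (forall i, (Jcoefs a ta)`_i = 0) -> (forall i, (Wcoefs a ta)`_i = 0) ->
  (forall i, (Ucoefs a ta)`_i = 0) -> cY a != 0 ->
  exists c, proportional a ta c.
Proof.
move=> J W U Y0.
have [c tY] : exists c, cY ta = c * cY a.
  by exists (cY ta / cY a); rewrite divfK.
exists c.
have PS : cPP a * cSS a = - (cCC a * cFF a).
  by rewrite /cPP /cSS /cCC /cFF; ring.
have := (J 5%N, J 6%N, J 7%N, J 9%N, J 10%N, J 11%N).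
have := (W 1%N, W 3%N, W 4%N, W 5%N, W 7%N, W 8%N, W 9%N, W 11%N, W 12%N,
         W 13%N, W 15%N).
have := (U 2%N, U 6%N, U 10%N, U 14%N).
rewrite {J W U}/= /wedge => -[[[U2 U6] U10] U14].
move=> [[[[[[[[[[W1 W3] W4] W5] W7] W8] W9] W11] W12] W13] W15].
move=> [[[[[J5 J6] J7] J9] J10] J11].
rewrite tY in W4 W8 W12 J5 J6 J7 J9 J10 J11.
have tCC : cCC ta = c * cCC a by clear -W4 Y0; apply: (mulIf Y0); lra.
have tCF : cCF ta = c * cCF a by clear -W8 Y0; apply: (mulIf Y0); lra.
have tFF : cFF ta = c * cFF a by clear -W12 Y0; apply: (mulIf Y0); lra.
have [E0|] := boolP [|| cCC a != 0, cCF a != 0 | cFF a != 0].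
  rewrite tCC tCF tFF in W1 W3 W5 W7 W9 W11 W13 W15 U2 U6 U10 U14.
  clear J5 J6 J7 J9 J10 J11 W4 W8 W12 PS.
  have [] := @conv_eq0 _ _ _ (cCP ta - c * cCP a) (cPF ta - c * cPF a) E0;
    [clear -W1 W5 W9 W13; lra..|move=> /subr0_eq tCP /subr0_eq tPF].
  have [] := @conv_eq0 _ _ _ (cCS ta - c * cCS a) (cSF ta - c * cSF a) E0;
    [clear -W3 W7 W11 W15; lra..|move=> /subr0_eq tCS /subr0_eq tSF].
  have [] := @conv_eq0 _ _ _ (cPP ta - c * cPP a) (cSS ta - c * cSS a) E0;
    [clear -U2 U6 U10 U14; lra..|move=> /subr0_eq tPP /subr0_eq tSS].
  exact: proportionalP.
rewrite !negb_or !negbK => /and3P[/eqP C0 /eqP CF0 /eqP F0].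
rewrite C0 CF0 F0 !(mulr0, mul0r, oppr0) in tCC tCF tFF PS J5 J6 J7 J9 J10 J11.
rewrite tCC tCF tFF in J5 J6 J7 J9 J10 J11.
have tPP : cPP ta = c * cPP a by clear -J6 Y0; apply: (mulIf Y0); lra.
have tSS : cSS ta = c * cSS a by clear -J10 Y0; apply: (mulIf Y0); lra.
rewrite tPP tSS in J5 J7 J9 J11.
(* One of [cPP a], [cSS a] vanishes. In the first case the equations are triangular in the order CP,
   CS, PF, SF, in the second in the reverse order. *)
move/eqP: PS; rewrite mulf_eq0 => /orP[] /eqP Z; rewrite Z in J5 J7 J9 J11.
  have tCP : cCP ta = c * cCP a by clear -J5 Y0; apply: (mulIf Y0); lra.
  rewrite tCP in J7.
  have tCS : cCS ta = c * cCS a by clear -J7 Y0; apply: (mulIf Y0); lra.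
  rewrite tCS in J9.
  have tPF : cPF ta = c * cPF a by clear -J9 Y0; apply: (mulIf Y0); lra.
  rewrite tPF in J11.
  have tSF : cSF ta = c * cSF a by clear -J11 Y0; apply: (mulIf Y0); lra.
  by apply: proportionalP => //; rewrite ?C0 ?CF0 ?F0 ?mulr0.
have tSF : cSF ta = c * cSF a by clear -J11 Y0; apply: (mulIf Y0); lra.
rewrite tSF in J9.
have tPF : cPF ta = c * cPF a by clear -J9 Y0; apply: (mulIf Y0); lra.
rewrite tPF in J7.
have tCS : cCS ta = c * cCS a by clear -J7 Y0; apply: (mulIf Y0); lra.
rewrite tCS in J5.
have tCP : cCP ta = c * cCP a by clear -J5 Y0; apply: (mulIf Y0); lra.
by apply: proportionalP => //; rewrite ?C0 ?CF0 ?F0 ?mulr0.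
Qed.

Definition low_eq0 a := [/\ cCC a = 0, cPP a = 0, cCS a = 0 & cCP a = 0].
Definition mid_eq0 a := [/\ cSS a = 0, cSF a = 0 & cPF a = 0].
(* If cCF = 0, this says that cCC + cFF x^2, cPP + cSS x, cCS + cSF x and
   cCP + cPF x are monomials: their ratios to those of [ta] may then still be a
   common power of x, which [low_eq0] and [mid_eq0] serve to exclude. *)
Definition monomial a := [/\ cCC a * cFF a = 0, cPP a * cSS a = 0,
  cCS a * cSF a = 0 & cCP a * cPF a = 0].

Lemma wedge_scaled {p q : (nat -> R) -> R} {a ta c} :
  p a != 0 -> p ta = c * p a ->
  wedge p q a ta = 0 -> q ta = c * q a.
Proof.
by rewrite /wedge => p0 -> h; apply: (mulIf p0); clear -h; lra.
Qed.

Lemma monomial_scaled {p q : (nat -> R) -> R} {a ta c} :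
  p a != 0 -> p ta = c * p a ->
  c != 0 -> p a * q a = 0 -> p ta * q ta = 0 -> q ta = c * q a.
Proof.
move=> p0 -> c0 /eqP; rewrite mulf_eq0 (negbTE p0) /= => /eqP -> /eqP.
by rewrite !mulf_eq0 (negbTE p0) (negbTE c0) /= mulr0 => /eqP.
Qed.

(** The constant c is the ratio at the first nonzero coefficient among CC, PP, CS, CP or, if there
    is none, among SS, SF, PF, FF. Most wedges vanish one by one; the pairs listed in [monomial]
    occur in no syzygy and are settled by c != 0, which [b1] supplies. *)
Lemma proportional_Y0 a ta :
  (forall i, (Jcoefs a ta)`_i = 0) -> (forall i, (Wcoefs a ta)`_i = 0) ->
  (forall i, (Ucoefs a ta)`_i = 0) ->
  cY a = 0 -> cY ta = 0 -> cCF a = 0 -> cCF ta = 0 ->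
  monomial a -> monomial ta ->
  (cCC a * cCS a = 0 -> low_eq0 ta -> low_eq0 a) ->
  (low_eq0 a -> low_eq0 ta /\ (mid_eq0 ta -> mid_eq0 a)) ->
  (low_eq0 a -> mid_eq0 a -> mid_eq0 ta) ->
  (low_eq0 a -> mid_eq0 a -> cFF a != 0) ->
  exists c, proportional a ta c.
Proof.
move=> J W U Y0 tY0 F0 tF0 [m1 m2 m3 m4] [tm1 tm2 tm3 tm4] b1 b2 b3 nz.
have wz (p q : (nat -> R) -> R) : p a = 0 -> p ta = 0 -> wedge p q a ta = 0.
  by rewrite /wedge => -> ->; rewrite !mul0r subrr.
have Yw q := wz cY q Y0 tY0; have Fw q := wz cCF q F0 tF0.
have := (J 2%N, J 3%N, J 4%N, J 5%N, J 6%N, J 7%N, J 8%N, J 9%N,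
  J 10%N, J 11%N).
have := (J 12%N, J 13%N, W 1%N, W 3%N, W 5%N, W 7%N, W 9%N, W 11%N).
have := (W 13%N, W 15%N, U 14%N).
rewrite {J W U}/= !Yw !Fw => -[[W13 W15] U14].
move=> [[[[[[[J12 J13] W1] W3] W5] W7] W9] W11].
move=> [[[[[[[[[J2 J3] J4] J5] J6] J7] J8] J9] J10] J11].
have tY c : cY ta = c * cY a by rewrite Y0 tY0 mulr0.
have tF c : cCF ta = c * cCF a by rewrite F0 tF0 mulr0.
have w1 : wedge cCC cCP a ta = 0 by clear -W1; lra.
have w2 : wedge cCC cPP a ta = 0 by clear -J2; lra.
have w3 : wedge cCC cCS a ta = 0 by clear -W3; lra.
have w4 : wedge cPP cCP a ta = 0 by clear -J3 w3; lra.
have w5 : wedge cCS cCP a ta = 0 by clear -J4; lra.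
have w6 : wedge cCC cPF a ta = 0 by clear -W5; lra.
have w7 : wedge cPP cCS a ta = 0 by clear -J5 w6; lra.
have w8 : wedge cCC cSS a ta = 0 by clear -J6; lra.
have w9 : wedge cCC cSF a ta = 0 by clear -W7; lra.
have w10 : wedge cFF cCP a ta = 0 by clear -W9; lra.
have w11 : wedge cFF cPP a ta = 0 by clear -J10; lra.
have w12 : wedge cFF cCS a ta = 0 by clear -W11; lra.
have w13 : wedge cSF cPF a ta = 0 by clear -J12; lra.
have w14 : wedge cSS cPF a ta = 0 by clear -J11 w12; lra.
have w15 : wedge cFF cPF a ta = 0 by clear -W13; lra.
have w16 : wedge cSS cSF a ta = 0 by clear -J13 w15; lra.
have w17 : wedge cFF cSS a ta = 0 by clear -U14; lra.
have w18 : wedge cFF cSF a ta = 0 by clear -W15; lra.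
have wC p q : wedge p q a ta = 0 -> wedge q p a ta = 0.
  by rewrite /wedge => h; clear -h; lra.
have ratio (p : (nat -> R) -> R) : p a != 0 -> exists c, p ta = c * p a.
  by move=> h; exists (p ta / p a); rewrite divfK.
clear U14 W13 W15 W1 W3 W5 W7 W9 W11 J12 J13.
have [C0|C0] := eqVneq (cCC a) 0; last first.
  have [c tC] := ratio _ C0; exists c.
  have tCP := wedge_scaled C0 tC w1; have tPP := wedge_scaled C0 tC w2.
  have tCS := wedge_scaled C0 tC w3.
  have tFF : cFF ta = c * cFF a.
    (* No syzygy contains [wedge cCC cFF]. A nonzero [cCS a] serves as intermediate; if it vanishes,
       [b1] applies. *)
    have [S0|S0] := eqVneq (cCS a) 0; last first.
      exact: wedge_scaled S0 tCS (wC _ _ w12).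
    have c0 : c != 0.
      apply: contraNneq C0 => c0; rewrite c0 !mul0r in tC tCP tPP tCS.
      by have [||->] := b1; rewrite ?S0 ?mulr0.
    exact: monomial_scaled C0 tC c0 m1 tm1.
  by apply: proportionalP; do ?[done | exact: wedge_scaled C0 tC _].
have [P0|P0] := eqVneq (cPP a) 0; last first.
  have [c tP] := ratio _ P0; exists c.
  have tC := wedge_scaled P0 tP (wC _ _ w2); have tCP := wedge_scaled P0 tP w4.
  have tCS := wedge_scaled P0 tP w7.
  have c0 : c != 0.
    apply: contraNneq P0 => c0; rewrite c0 !mul0r in tC tCP tP tCS.
    by have [||_ ->] := b1; rewrite ?C0 ?mul0r.
  have tSS := monomial_scaled P0 tP c0 m2 tm2.
  have tFF := wedge_scaled P0 tP (wC _ _ w11).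
  (* [J7] only controls a sum of this wedge and [wedge cSS cCP]; the latter vanishes because [cSS]
     is zero for both problems. *)
  have w19 : wedge cPP cPF a ta = 0.
    suff : wedge cSS cCP a ta = 0 by move=> h; clear -h J7 w9 w12; lra.
    move/eqP: m2; rewrite mulf_eq0 (negbTE P0) /= => /eqP m2.
    by apply: wz => //; rewrite tSS m2 mulr0.
  have w20 : wedge cPP cSF a ta = 0.
    suff : wedge cSS cCS a ta = 0 by move=> h; clear -h J9 w10; lra.
    move/eqP: m2; rewrite mulf_eq0 (negbTE P0) /= => /eqP m2.
    by apply: wz => //; rewrite tSS m2 mulr0.
  by apply: proportionalP; do ?[done | exact: wedge_scaled P0 tP _].
have [S0|S0] := eqVneq (cCS a) 0; last first.
  have [c tS] := ratio _ S0; exists c.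
  have tC := wedge_scaled S0 tS (wC _ _ w3); have tCP := wedge_scaled S0 tS w5.
  have tP := wedge_scaled S0 tS (wC _ _ w7).
  have c0 : c != 0.
    apply: contraNneq S0 => c0; rewrite c0 !mul0r in tC tCP tP tS.
    by have [||_ _ ->] := b1; rewrite ?C0 ?mul0r.
  have tSF := monomial_scaled S0 tS c0 m3 tm3.
  have tFF := wedge_scaled S0 tS (wC _ _ w12).
  have zP : cPP ta = 0 by rewrite tP P0 mulr0.
  have w19 : wedge cCS cPF a ta = 0.
    suff : wedge cSF cCP a ta = 0 by move=> h; clear -h J8; lra.
    move/eqP: m3; rewrite mulf_eq0 (negbTE S0) /= => /eqP m3.
    by apply: wz => //; rewrite tSF m3 mulr0.
  have w20 : wedge cCS cSS a ta = 0.
    apply: wC; suff : wedge cPP cSF a ta = 0 by move=> h; clear -h J9 w10; lra.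
    exact: wz.
  by apply: proportionalP; do ?[done | exact: wedge_scaled S0 tS _].
have [Q0|Q0] := eqVneq (cCP a) 0; last first.
  have [c tQ] := ratio _ Q0; exists c.
  have tC := wedge_scaled Q0 tQ (wC _ _ w1).
  have tS := wedge_scaled Q0 tQ (wC _ _ w5).
  have tP := wedge_scaled Q0 tQ (wC _ _ w4).
  have c0 : c != 0.
    apply: contraNneq Q0 => c0; rewrite c0 !mul0r in tC tS tP tQ.
    by have [||_ _ _ ->] := b1; rewrite ?C0 ?mul0r.
  have tPF := monomial_scaled Q0 tQ c0 m4 tm4.
  have tFF := wedge_scaled Q0 tQ (wC _ _ w10).
  have zP : cPP ta = 0 by rewrite tP P0 mulr0.
  have zS : cCS ta = 0 by rewrite tS S0 mulr0.
  have w19 : wedge cCP cSF a ta = 0.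
    have h0 : wedge cCS cPF a ta = 0 by exact: wz.
    by apply: wC; clear -h0 J8; lra.
  have w20 : wedge cCP cSS a ta = 0.
    have h0 : wedge cPP cPF a ta = 0 by exact: wz.
    by apply: wC; clear -h0 J7 w9 w12; lra.
  by apply: proportionalP; do ?[done | exact: wedge_scaled Q0 tQ _].
(* From here on CC, PP, CS, CP vanish for both problems, and every wedge among SS, SF, PF, FF is
   known to be zero. *)
have [|[tC tP tS tQ] b4] := b2; first by split.
have zz (p : (nat -> R) -> R) c : p a = 0 -> p ta = 0 -> p ta = c * p a.
  by move=> -> ->; rewrite mulr0.
have tSS p c : p a != 0 -> p ta = c * p a -> wedge p cSS a ta = 0 ->
    wedge p cSF a ta = 0 -> wedge p cPF a ta = 0 -> wedge p cFF a ta = 0 ->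
    exists c, proportional a ta c.
  move=> p0 tp h1 h2 h3 h4; exists c.
  by apply: proportionalP; do ?[exact: zz | exact: wedge_scaled p0 tp _].
have ww p : wedge p p a ta = 0 by rewrite /wedge mulrC subrr.
have [S1|S1] := eqVneq (cSS a) 0; last first.
  by have [c tp] := ratio _ S1; apply: tSS S1 tp _ _ _ _;
    do ?[done | exact: ww | exact: wC].
have [S2|S2] := eqVneq (cSF a) 0; last first.
  by have [c tp] := ratio _ S2; apply: tSS S2 tp _ _ _ _;
    do ?[done | exact: ww | exact: wC].
have [S3|S3] := eqVneq (cPF a) 0; last first.
  by have [c tp] := ratio _ S3; apply: tSS S3 tp _ _ _ _;
    do ?[done | exact: ww | exact: wC].
have [||tS1 tS2 tS3] := b3; [by split..|].
have [|c tp] := ratio cFF; first by apply: nz; split.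
by exists c; apply: proportionalP; do ?[exact: zz | exact: tp].
Qed.

(** * Recovering the boundary conditions from the coefficients *)

Lemma tensor_parallel (k x1 x2 y1 y2 X1 X2 Y1 Y2 : R) :
  0 < X1 + X2 -> 0 < Y1 + Y2 ->
  X1 * Y1 = k * (x1 * y1) -> X1 * Y2 = k * (x1 * y2) ->
  X2 * Y1 = k * (x2 * y1) -> X2 * Y2 = k * (x2 * y2) ->
  exists m n, [/\ m != 0, n != 0, X1 = m * x1 /\ X2 = m * x2 &
    Y1 = n * y1 /\ Y2 = n * y2].
Proof.
move=> X0 Y0 h11 h12 h21 h22.
have : k * (x1 + x2) * (y1 + y2) != 0.
  have -> : k * (x1 + x2) * (y1 + y2) = (X1 + X2) * (Y1 + Y2).
    by clear -h11 h12 h21 h22; lra.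
  by rewrite mulf_neq0 // gt_eqF.
rewrite !mulf_eq0 !negb_or => /andP[/andP[k0 x0] y0].
move/lt0r_neq0: X0 => X0; move/lt0r_neq0: Y0 => Y0.
(* The multipliers result from contracting one tensor factor with (1, 1). *)
exists (k * (y1 + y2) / (Y1 + Y2)), (k * (x1 + x2) / (X1 + X2)).
split; rewrite ?mulf_neq0 ?invr_eq0 //; split.
- by apply: (mulIf Y0); rewrite [RHS]mulrAC divfK //; clear -h11 h12; lra.
- by apply: (mulIf Y0); rewrite [RHS]mulrAC divfK //; clear -h21 h22; lra.
- by apply: (mulIf X0); rewrite [RHS]mulrAC divfK //; clear -h11 h21; lra.
- by apply: (mulIf X0); rewrite [RHS]mulrAC divfK //; clear -h12 h22; lra.
Qed.

(** The index blocks 1..4 and 5..8 are exchanged, so that [bc_mx (swap_ends a)] computes to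
    [bc_mx_star a]. *)
Definition swap_ends a (i : nat) := a (if (i <= 4)%N then i + 4 else i - 4)%N.

Definition same_conditions a b := exists m1 m2 m3 m4 : R,
  [/\ [/\ m1 != 0, m2 != 0, m3 != 0 & m4 != 0],
      b 1%N = m1 * a 1%N /\ b 4%N = m1 * a 4%N,
      b 2%N = m2 * a 2%N /\ b 3%N = m2 * a 3%N,
      b 5%N = m3 * a 5%N /\ b 8%N = m3 * a 8%N &
      b 6%N = m4 * a 6%N /\ b 7%N = m4 * a 7%N].

Lemma qA_gt0 a : nondegenerate a -> 0 < qA0 a + qA1 a + qA2 a.
Proof.
case=> _ h1 _ h2 _; have := mulr_gt0 h1 h2.
by rewrite /qA0 /qA1 /qA2 => h; clear -h; lra.
Qed.

Lemma qB_gt0 a : nondegenerate a -> 0 < qB0 a + qB1 a + qB2 a.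
Proof.
case=> _ _ h1 _ h2; have := mulr_gt0 h1 h2.
by rewrite /qB0 /qB1 /qB2 => h; clear -h; lra.
Qed.

(* With dA = a1 a8 - a4 a5 and dB = a2 a7 - a3 a6, the squares of dA and dB are
   the discriminants of the binary quadratic forms (qA0, qA1, qA2) and
   (qB0, qB1, qB2), and dA * dB = cY - 2 cCF: the last coefficient forces
   the ends of both pairs of conditions to be exchanged simultaneously. *)
Lemma same_conditions_of_proportional a ta c :
  nondegenerate a -> nondegenerate ta -> proportional a ta c ->
  same_conditions a ta \/ same_conditions a (swap_ends ta).
Proof.
move=> na nt pr.
have A0 := qA_gt0 _ na; have tA0 := qA_gt0 _ nt.
have B0 := qB_gt0 _ na; have tB0 := qB_gt0 _ nt.
have pCC : cCC ta = c * cCC a by apply: pr; do ?[by left | right].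
have pCP : cCP ta = c * cCP a by apply: pr; do ?[by left | right].
have pPP : cPP ta = c * cPP a by apply: pr; do ?[by left | right].
have pCS : cCS ta = c * cCS a by apply: pr; do ?[by left | right].
have pY : cY ta = c * cY a by apply: pr; do ?[by left | right].
have pPF : cPF ta = c * cPF a by apply: pr; do ?[by left | right].
have pSS : cSS ta = c * cSS a by apply: pr; do ?[by left | right].
have pSF : cSF ta = c * cSF a by apply: pr; do ?[by left | right].
have pFF : cFF ta = c * cFF a by apply: pr; do ?[by left | right].
have pCF : cCF ta = c * cCF a by apply: pr; do ?[by left | right].
rewrite /cCC /cCP /cPP /cCS /cY /cPF /cSS /cSF /cFF in
  pCC pCP pPP pCS pY pPF pSS pSF pFF.
(* Summing over the index of qB with that of qA fixed gives k as c times a ratio of values of the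
   B-forms at (1, 1). *)
have [k [kA0 kA1 kA2]] : exists k, [/\ qA0 ta = k * qA0 a, qA1 ta = k * qA1 a &
    qA2 ta = k * qA2 a].
  move/lt0r_neq0: tB0 => tB0.
  exists (c * (qB0 a + qB1 a + qB2 a) / (qB0 ta + qB1 ta + qB2 ta)).
  split; apply: (mulIf tB0); rewrite [RHS]mulrAC divfK //.
  - by clear -pCC pCP pPP; lra.
  - by clear -pCS pY pPF; lra.
  - by clear -pSS pSF pFF; lra.
have [k' [kB0 kB1 kB2]] : exists k, [/\ qB0 ta = k * qB0 a, qB1 ta = k * qB1 a &
    qB2 ta = k * qB2 a].
  move/lt0r_neq0: tA0 => tA0'.
  exists (c * (qA0 a + qA1 a + qA2 a) / (qA0 ta + qA1 ta + qA2 ta)).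
  split; apply: (mulIf tA0'); rewrite [RHS]mulrAC divfK //.
  - by clear -pCC pCS pSS; lra.
  - by clear -pCP pY pSF; lra.
  - by clear -pPP pPF pFF; lra.
have ck : k * k' = c.
  apply: (mulIf (lt0r_neq0 (mulr_gt0 A0 B0))).
  move: pCC pCP pPP pCS pY pPF pSS pSF pFF; rewrite kA0 kA1 kA2 kB0 kB1 kB2.
  by clear=> *; lra.
have [k0 k0'] : k != 0 /\ k' != 0.
  split; [move: tA0; rewrite kA0 kA1 kA2 | move: tB0; rewrite kB0 kB1 kB2];
    by apply: contraTneq => ->; rewrite !mul0r !addr0 ltxx.
pose dA (b : nat -> R) := b 1%N * b 8%N - b 4%N * b 5%N.
pose dB (b : nat -> R) := b 2%N * b 7%N - b 3%N * b 6%N.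
have dAE : (dA ta == k * dA a) || (dA ta == - (k * dA a)).
  rewrite -eqf_sqr; apply/eqP.
  transitivity (qA1 ta ^+ 2 - 4 * (qA0 ta * qA2 ta)).
    by rewrite /dA /qA1 /qA0 /qA2; ring.
  by rewrite kA0 kA1 kA2 /dA /qA1 /qA0 /qA2; ring.
have dBE : (dB ta == k' * dB a) || (dB ta == - (k' * dB a)).
  rewrite -eqf_sqr; apply/eqP.
  transitivity (qB1 ta ^+ 2 - 4 * (qB0 ta * qB2 ta)).
    by rewrite /dB /qB1 /qB0 /qB2; ring.
  by rewrite kB0 kB1 kB2 /dB /qB1 /qB0 /qB2; ring.
have dAB : dA ta * dB ta = (k * dA a) * (k' * dB a).
  have e b : dA b * dB b = - (qA1 b * qB1 b) - 2 * cCF b.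
    by rewrite /dA /dB /cCF /qA1 /qB1; ring.
  by rewrite [RHS]mulrACA !e pCF pY -ck; ring.
have [[eA eB]|[eA eB]] : (dA ta = k * dA a /\ dB ta = k' * dB a) \/
    (dA ta = - (k * dA a) /\ dB ta = - (k' * dB a)).
  (* If the signs disagree, [dAB] forces one of the two square roots to vanish, and zero fits either
     sign. *)
  case/orP: dAE => /eqP eA; case/orP: dBE => /eqP eB; try by [left|right].
    move: dAB; rewrite eA eB mulrN => /eqP.
    by rewrite eqNr mulf_eq0 => /orP[] /eqP z; rewrite z ?oppr0; [right|left].
  move: dAB; rewrite eA eB mulNr => /eqP.
  by rewrite eqNr mulf_eq0 => /orP[] /eqP z; rewrite z ?oppr0; [left|right].
all: rewrite /dA /dB in eA eB; rewrite /qA0 /qA1 /qA2 in kA0 kA1 kA2;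
  rewrite /qB0 /qB1 /qB2 in kB0 kB1 kB2; case: nt => _ n1 n2 n3 n4.
(* [kA1] and [eA] together determine a1 a8 and a4 a5 separately, which makes the tensors
   proportional; with the minus sign these two products are exchanged. *)
- left.
  have [||||m1 [m3 [? ? ? ?]]] :=
    tensor_parallel k (a 1%N) (a 4%N) (a 5%N) (a 8%N) _ _ _ _ n1 n3;
    [by clear -eA kA0 kA1 kA2; lra..|].
  have [||||m2 [m4 [? ? ? ?]]] :=
    tensor_parallel k' (a 2%N) (a 3%N) (a 6%N) (a 7%N) _ _ _ _ n2 n4;
    [by clear -eB kB0 kB1 kB2; lra..|].
  by exists m1, m2, m3, m4.
- right.
  have [||||m3 [m1 [? ? ? ?]]] :=
    tensor_parallel k (a 5%N) (a 8%N) (a 1%N) (a 4%N) _ _ _ _ n1 n3;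
    [by clear -eA kA0 kA1 kA2; lra..|].
  have [||||m4 [m2 [? ? ? ?]]] :=
    tensor_parallel k' (a 6%N) (a 7%N) (a 2%N) (a 3%N) _ _ _ _ n2 n4;
    [by clear -eB kB0 kB1 kB2; lra..|].
  by exists m1, m2, m3, m4.
Qed.

(** * Order of vanishing at s = 0 *)

Definition syzygies a ta := [/\ forall i, (Jcoefs a ta)`_i = 0,
  forall i, (Wcoefs a ta)`_i = 0 & forall i, (Ucoefs a ta)`_i = 0].

(* [lead0] is the value of the characteristic function at s = 0; if all its
   terms vanish then [lead1] is the coefficient of s^2. *)
Definition lead0 (l : R) a := cCC a * (l ^+ 4 / 12) + cCP a * (l ^+ 3 / 3) +
  cPP a * l ^+ 2 + cCS a * l + cY a.
Definition lead1 (l : R) a :=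
  cPF a * (l ^+ 3 / 3) + cSS a * l ^+ 2 + cSF a * l.

(** The nine products of a qA by a qB add up to the product of the positive values of both forms at
    (1, 1), so they cannot all vanish. *)
Lemma nondegenerate_neq0 a : nondegenerate a -> cY a = 0 ->
  low_eq0 a -> mid_eq0 a -> cFF a != 0.
Proof.
move=> na Y0 [C0 P0 S0 Q0] [SS0 SF0 PF0].
have := lt0r_neq0 (mulr_gt0 (qA_gt0 _ na) (qB_gt0 _ na)).
apply: contraNneq => F0; move: Y0 C0 P0 S0 Q0 SS0 SF0 PF0 F0.
rewrite /cCC /cCP /cPP /cCS /cY /cPF /cSS /cSF /cFF.
by move=> e1 e2 e3 e4 e5 e6 e7 e8 e9; apply/eqP;
  clear -e1 e2 e3 e4 e5 e6 e7 e8 e9; lra.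
Qed.

Lemma addr_eq0_ge0 {x y : R} : 0 <= x -> 0 <= y -> x + y = 0 -> x = 0 /\ y = 0.
Proof.
by move=> x0 y0 /eqP; rewrite paddr_eq0 // => /andP[/eqP -> /eqP ->].
Qed.

(** [- cY a] is a sum of four nonnegative products, which therefore vanish; [cCF a] and the four
    products in [monomial] consist of such terms or have one, or [cY a], as a factor. *)
Lemma nondegenerate_monomial a : nondegenerate a -> cY a = 0 ->
  cCF a = 0 /\ monomial a.
Proof.
case=> a0 _ _ _ _ Y0.
have h i j k m : (0 < i <= 8)%N -> (0 < j <= 8)%N -> (0 < k <= 8)%N ->
    (0 < m <= 8)%N -> 0 <= a i * a j * a k * a m.
  by move=> *; rewrite !mulr_ge0 ?a0.
have : a 1%N * a 8%N * a 2%N * a 7%N + a 1%N * a 8%N * a 3%N * a 6%N +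
   (a 4%N * a 5%N * a 2%N * a 7%N + a 4%N * a 5%N * a 3%N * a 6%N) = 0.
  by apply: oppr_inj; rewrite oppr0 -Y0 /cY /qA1 /qB1; ring.
case/addr_eq0_ge0; rewrite ?addr_ge0 ?h //.
case/addr_eq0_ge0; rewrite ?h // => z1 z2.
case/addr_eq0_ge0; rewrite ?h // => z3 z4.
split; first by rewrite /cCF; clear -z1 z4; lra.
split.
- transitivity ((a 1%N * a 8%N * a 2%N * a 7%N) *
      (a 4%N * a 5%N * a 3%N * a 6%N)).
    by rewrite /cCC /cFF /qA0 /qB0 /qA2 /qB2; ring.
  by rewrite z1 mul0r.
- transitivity (- ((a 1%N * a 8%N * a 2%N * a 7%N) *
      (a 4%N * a 5%N * a 3%N * a 6%N))).
    by rewrite /cPP /cSS /qA0 /qB0 /qA2 /qB2; ring.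
  by rewrite z1 mul0r oppr0.
- transitivity (- (qA2 a * qB0 a * cY a)); last by rewrite Y0 mulr0 oppr0.
  by rewrite /cCS /cSF /cY; ring.
- transitivity (- (qA0 a * qB2 a * cY a)); last by rewrite Y0 mulr0 oppr0.
  by rewrite /cCP /cPF /cY; ring.
Qed.

Lemma proportional_sym a ta c : nondegenerate a -> proportional ta a c ->
  exists d, proportional a ta d.
Proof.
move=> na pc; exists c^-1; suff c0 : c != 0 by move=> p /pc ->; rewrite mulKf.
apply/negP => /eqP c0.
have z (p : (nat -> R) -> R) : List.In p
    [:: cCC; cCP; cPP; cCS; cY; cPF; cSS; cSF; cFF; cCF] -> p a = 0.
  by move=> /pc ->; rewrite c0 mul0r.
have := nondegenerate_neq0 _ na; rewrite (z cFF) ?eqxx.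
  by move=> /(_ _ _ _)/notF; apply; try split; apply: z; do ?[by left | right].
by do ?[by left | right].
Qed.

(** If [qA1 a] is nonzero then [qB1 a] is zero, so its two nonnegative terms vanish; their product
    is [qB0 a * qB2 a]. *)
Lemma qA1B0B2_eq0 a : nondegenerate a -> cY a = 0 ->
  qA1 a * (qB0 a * qB2 a) = 0.
Proof.
case=> a0 _ _ _ _ /eqP; rewrite oppr_eq0 mulf_eq0 => /orP[/eqP->|/eqP B1].
  by rewrite mul0r.
have [z1 z2] : a 2%N * a 7%N = 0 /\ a 3%N * a 6%N = 0.
  by apply: addr_eq0_ge0; rewrite ?mulr_ge0 ?a0.
transitivity (qA1 a * (a 2%N * a 7%N) * (a 3%N * a 6%N)).
  by rewrite /qB0 /qB2; ring.
by rewrite z2 mulr0.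
Qed.

(** There is no cancellation: [cCS a] is the only coefficient of the wrong sign, and its products
    with the others are zero, so it either vanishes or stands alone. *)
Lemma lead0_eq0 l a : 0 < l -> nondegenerate a -> cY a = 0 ->
  cCC a * cCS a = 0 -> lead0 l a = 0 <-> low_eq0 a.
Proof.
move=> l0 na Y0 CS0; split; last first.
  by case=> C0 P0 S0 Q0; rewrite /lead0 C0 P0 S0 Q0 Y0 !mul0r !addr0.
have [a0 _ _ _ _] := na.
have C0 : 0 <= cCC a by rewrite /cCC /qA0 /qB0 !mulr_ge0 ?a0.
have P0 : 0 <= cPP a by rewrite /cPP /qA0 /qB2 !mulr_ge0 ?a0.
have Q0 : 0 <= cCP a by rewrite /cCP /qA0 /qB1 mulr_ge0 ?addr_ge0 ?mulr_ge0 ?a0.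
have QS : cCP a * cCS a = 0.
  transitivity (qA0 a * qB0 a * cY a); last by rewrite Y0 mulr0.
  by rewrite /cCP /cCS /cY; ring.
have PS : cPP a * cCS a = 0.
  transitivity (- (qA0 a * (qA1 a * (qB0 a * qB2 a)))).
    by rewrite /cPP /cCS; ring.
  by rewrite qA1B0B2_eq0 // mulr0 oppr0.
rewrite /lead0 Y0 addr0; have [S0|S0] := eqVneq (cCS a) 0.
  rewrite S0 mul0r addr0.
  have l2 : 0 < l ^+ 2 by rewrite exprn_gt0.
  have l3 : 0 < l ^+ 3 / 3 by rewrite divr_gt0 ?exprn_gt0.
  have l4 : 0 < l ^+ 4 / 12 by rewrite divr_gt0 ?exprn_gt0.
  have h4 := mulr_ge0 C0 (ltW l4); have h3 := mulr_ge0 Q0 (ltW l3).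
  have h2 := mulr_ge0 P0 (ltW l2).
  case/(addr_eq0_ge0 (addr_ge0 h4 h3) h2) => /(addr_eq0_ge0 h4 h3)[].
  move=> /eqP; rewrite mulf_eq0 (gt_eqF l4) orbF => /eqP ?.
  move=> /eqP; rewrite mulf_eq0 (gt_eqF l3) orbF => /eqP ?.
  by move=> /eqP; rewrite mulf_eq0 (gt_eqF l2) orbF => /eqP ?.
have z (x : R) : x * cCS a = 0 -> x = 0.
  by move=> /eqP; rewrite mulf_eq0 (negbTE S0) orbF => /eqP.
rewrite (z _ CS0) (z _ QS) (z _ PS) !mul0r !add0r => /eqP.
by rewrite mulf_eq0 (negbTE S0) gt_eqF.
Qed.

(** The same absence of cancellation, now for [cPF] against the nonpositive [cSS] and [cSF]. *)
Lemma lead1_eq0 l a : 0 < l -> nondegenerate a -> cY a = 0 ->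
  lead1 l a = 0 <-> mid_eq0 a.
Proof.
move=> l0 na Y0; split; last first.
  by case=> S0 F0 P0; rewrite /lead1 S0 F0 P0 !mul0r !addr0.
have [a0 _ _ _ _] := na.
have S0 : 0 <= - cSS a by rewrite opprK /qA2 /qB0 !mulr_ge0 ?a0.
have F0 : 0 <= - cSF a.
  by rewrite opprK /qA2 /qB1 mulr_ge0 ?addr_ge0 ?mulr_ge0 ?a0.
have l2 : 0 < l ^+ 2 by rewrite exprn_gt0.
have l3 : 0 < l ^+ 3 / 3 by rewrite divr_gt0 ?exprn_gt0.
have PF : cPF a * cSF a = 0.
  transitivity (qA2 a * qB2 a * cY a); last by rewrite Y0 mulr0.
  by rewrite /cPF /cSF /cY; ring.
have PS : cPF a * cSS a = 0.
  transitivity (- (qA2 a * (qA1 a * (qB0 a * qB2 a)))).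
    by rewrite /cPF /cSS; ring.
  by rewrite qA1B0B2_eq0 // mulr0 oppr0.
rewrite /lead1; have [P0|P0] := eqVneq (cPF a) 0.
  rewrite P0 mul0r add0r => h.
  have h2 := mulr_ge0 S0 (ltW l2); have h3 := mulr_ge0 F0 (ltW l0).
  have [] := addr_eq0_ge0 h2 h3; first by clear -h; lra.
  move=> /eqP; rewrite mulf_eq0 (gt_eqF l2) orbF oppr_eq0 => /eqP ?.
  by move=> /eqP; rewrite mulf_eq0 (gt_eqF l0) orbF oppr_eq0 => /eqP ?.
have z (x : R) : cPF a * x = 0 -> x = 0.
  by move=> /eqP; rewrite mulf_eq0 (negbTE P0) => /eqP.
rewrite (z _ PF) (z _ PS) !mul0r !addr0 => /eqP.
by rewrite mulf_eq0 (negbTE P0) (gt_eqF l3).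
Qed.

Lemma same_conditions_of_syzygies l a ta : 0 < l ->
  nondegenerate a -> nondegenerate ta -> syzygies a ta -> syzygies ta a ->
  (lead0 l a = 0 <-> lead0 l ta = 0) ->
  (cY a = 0 -> cY ta = 0 -> low_eq0 a -> low_eq0 ta ->
    (lead1 l a = 0 <-> lead1 l ta = 0)) ->
  same_conditions a ta \/ same_conditions a (swap_ends ta).
Proof.
move=> l0 na nt [J W U] [J' W' U'] ord ord'.
suff [c pc] : exists c, proportional a ta c.
  exact: same_conditions_of_proportional pc.
have [Y0|Y0] := eqVneq (cY a) 0; last exact: proportional_Y.
have [Y0'|Y0'] := eqVneq (cY ta) 0; last first.
  have [c pc] := proportional_Y _ _ J' W' U' Y0'.
  exact: proportional_sym pc.
have [F0 ma] := nondegenerate_monomial _ na Y0.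
have [F0' mt] := nondegenerate_monomial _ nt Y0'.
(* If this product is nonzero, [low_eq0 ta] fails, and with the roles of the two problems exchanged
   the last four premises of [proportional_Y0] hold vacuously. *)
have [CS|CS] := eqVneq (cCC ta * cCS ta) 0; last first.
  have nb : ~ low_eq0 ta by case=> C0 _ _ _; rewrite C0 mul0r eqxx in CS.
  suff [c pc] : exists c, proportional ta a c by exact: proportional_sym pc.
  by apply: proportional_Y0 => // h; rewrite h eqxx in CS.
have bt : lead0 l a = 0 -> low_eq0 ta.
  by move=> h; apply/(lead0_eq0 _ _ l0 nt Y0' CS); apply ord.
have bl b : cY b = 0 -> low_eq0 b -> lead0 l b = 0.
  by move=> Y [C0 P0 S0 Q0]; rewrite /lead0 C0 P0 S0 Q0 Y !mul0r !addr0.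
have mE b : nondegenerate b -> cY b = 0 -> lead1 l b = 0 <-> mid_eq0 b.
  by move=> ? ?; apply: lead1_eq0.
apply: proportional_Y0 => //.
- move=> h b; apply/(lead0_eq0 _ _ l0 na Y0 h); apply ord; exact: bl.
- move=> h; have h' : low_eq0 ta by apply: bt; exact: bl.
  by split=> // h1; apply/mE => //; apply (ord' Y0 Y0' h h'); apply/mE.
- move=> h; have h' : low_eq0 ta by apply: bt; exact: bl.
  by move=> h1; apply/mE => //; apply (ord' Y0 Y0' h h'); apply/mE.
- exact: nondegenerate_neq0.
Qed.
End CoefficientAlgebra.

(** * Common large real zeros *)

Section Asymptotics.
Context {R : realType} {l : R} (l_gt0 : 0 < l).
Implicit Types (p q r e : {poly R}) (z M : R).

(** Induction on p: half of the rate k absorbs the smaller polynomial, two quarters absorb z +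
    |c|. *)
Lemma poly_lt_expR (k : R) p : 0 < k -> exists M, forall z, M < z ->
  `|p.[z]| < expR (z * k).
Proof.
elim/poly_ind: p k => [|p c IH] k k0.
  by exists 0 => z _; rewrite horner0 normr0 expR_gt0.
have [M HM] := IH (k / 2) (divr_gt0 k0 (ltr0Sn _ _)).
(* Beyond the last threshold (z k / 4)^2 is at least z (1 + |c|), hence at least z + |c| as z >
   1. *)
exists (Num.max M (Num.max 1 (16 * (1 + `|c|) / k ^+ 2))) => z.
rewrite !gt_max => /and3P[Mz z1 zc].
have z0 : 0 < z by apply: lt_trans z1.
have -> : z * k = z * (k / 2) + (z * (k / 4) + z * (k / 4)) by field.
rewrite !expRD hornerMXaddC; set X := expR (z * (k / 2)).
apply: (@le_lt_trans _ _ (X * (z + `|c|))).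
  have X1 : 1 <= X.
    by rewrite -[1]addr0 (le_trans _ (expR_ge1Dx _)) // lerD2l
      mulr_ge0 ?divr_ge0 // ltW.
  apply: (le_trans (ler_normD _ _)); rewrite normrM (gtr0_norm z0) mulrDr.
  apply: lerD; first by rewrite ler_pM2r // ltW // HM.
  by rewrite ler_peMl.
rewrite ltr_pM2l; last exact: expR_gt0.
have h : z * (k / 4) < expR (z * (k / 4)).
  by apply: lt_le_trans (expR_ge1Dx _); rewrite ltrDr.
have h0 : 0 <= z * (k / 4) by rewrite mulr_ge0 ?divr_ge0 // ltW.
apply: (@le_lt_trans _ _ (z * (k / 4) * (z * (k / 4)))); last exact: ltr_pM.
have : 16 * (1 + `|c|) < z * k ^+ 2 by rewrite -ltr_pdivrMr ?exprn_gt0.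
have c0 := normr_ge0 c.
set d := `|c| in c0 *; move=> hh.
have -> : z * (k / 4) * (z * (k / 4)) = z * (z * k ^+ 2) / 16 by field.
rewrite ler_pdivlMr //.
apply: (@le_trans _ _ (z * (16 * (1 + d)))); last by rewrite ler_pM2l // ltW.
by clear -c0 z1; nra.
Qed.

Lemma poly_bounded_away p : p != 0 -> exists s d M, [/\ s ^+ 2 = 1, 0 < d &
  forall z, M < z -> d <= s * p.[z]].
Proof.
move=> p0; have : lead_coef p != 0 by rewrite lead_coef_eq0.
have hp q : 0 < lead_coef q ->
    exists d M, 0 < d /\ forall z, M < z -> d <= q.[z].
  move=> q0; have [M hM] := poly_pinfty_gt_lc q0.
  by exists (lead_coef q), M; split=> // z /ltW /hM.
rewrite neq_lt => /orP[pn|/hp[d [M [d0 H]]]]; last first.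
  by exists 1, d, M; split=> // [|z /H]; rewrite ?expr1n ?mul1r.
have [|d [M [d0 H]]] := hp (- p); first by rewrite lead_coefN oppr_gt0.
exists (-1), d, M; split=> // [|z /H]; first by rewrite sqrrN expr1n.
by rewrite hornerN mulN1r.
Qed.

(** The sign s and the threshold M do not depend on t, which stands for all terms without the factor
    exp(zl). *)
Lemma poly_expR_dominates p q : p != 0 -> exists s M, s ^+ 2 = 1 /\
  forall z t, M < z -> `|t| <= q.[z] -> 0 < s * (p.[z] * expR (z * l) + t).
Proof.
move=> /poly_bounded_away[s [d [M1 [s1 d0 h1]]]].
have [M2 h2] := poly_lt_expR l (d^-1 *: q) l_gt0.
exists s, (Num.max M1 M2); split=> // z t; rewrite gt_max => /andP[z1 z2] tq.
rewrite mulrDr mulrA.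
have {}h2 : q.[z] < d * expR (z * l).
  have := le_lt_trans (ler_norm _) (h2 _ z2).
  by rewrite hornerZ ltr_pdivrMl.
have : d * expR (z * l) <= s * p.[z] * expR (z * l).
  by rewrite ler_pM2r ?expR_gt0 // h1.
have : `|s * t| <= q.[z].
  rewrite normrM (_ : `|s| = 1) ?mul1r //.
  by apply/eqP; rewrite -sqrp_eq1 ?normr_ge0 // real_normK ?num_real // s1.
rewrite ler_norml => /andP[+ _].
by move: (s * t) (s * _ * _) (d * _) h2 => A B C h2 h3 h4; lra.
Qed.

(** For p nonzero, t = - p exp(zl) would make a sum of definite sign vanish. *)
Lemma poly_eq0_of_expR p q :
  (forall M, exists2 z, M < z & `|p.[z]| * expR (z * l) <= q.[z]) -> p = 0.
Proof.
move=> H; apply/eqP; apply/negP => /negP /(poly_expR_dominates _ q).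
move=> [s [M [_ h]]]; have [z Mz hz] := H M.
have := h z (- (p.[z] * expR (z * l))) Mz.
rewrite normrN normrM (gtr0_norm (expR_gt0 _)) subrr mulr0 ltxx => hh.
by have := hh hz.
Qed.

(* For [e] even this is even in z: this fixes the coefficients of exp(-zl). *)
Definition exp_trig e al be z :=
  2 * e.[z] + (al.[z] * cos (z * l) + be.[z] * sin (z * l)) * expR (z * l)
  + (al.[- z] * cos (z * l) - be.[- z] * sin (z * l)) * expR (- (z * l)).

Lemma continuous_exp_trig e al be : continuous (exp_trig e al be).
Proof.
move=> z; have cl : {for z, continuous (fun y : R => y * l)}.
  by apply: cvgM; [exact: cvg_id|exact: cvg_cst].
have cN p : {for z, continuous (fun y : R => p.[- y])}.
  apply: (@continuous_comp _ _ _ (fun y => - y) (horner p)).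
    exact: opp_continuous.
  exact: continuous_horner.
have cc : {for z, continuous (fun y : R => cos (y * l))}.
  by apply: (continuous_comp cl); exact: continuous_cos.
have cs : {for z, continuous (fun y : R => sin (y * l))}.
  by apply: (continuous_comp cl); exact: continuous_sin.
have ce : {for z, continuous (fun y : R => expR (y * l))}.
  by apply: (continuous_comp cl); exact: continuous_expR.
have ceN : {for z, continuous (fun y : R => expR (- (y * l)))}.
  have clN : {for z, continuous (fun y : R => - (y * l))}.
    by apply: cvgN; exact: cl.
  by apply: (continuous_comp clN); exact: continuous_expR.
have ch p : {for z, continuous (horner p)} by exact: continuous_horner.
apply: cvgD; last apply: cvgM => //.
  apply: cvgD; first by apply: cvgM; [exact: cvg_cst|exact: ch].
  by apply: cvgM => //; apply: cvgD; apply: cvgM => //; exact: ch.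
by apply: cvgB; apply: cvgM => //; exact: cN.
Qed.

(** With phi such that p = cos phi al + sin phi be is nonzero, the factor of exp(zl) is p at zl =
    phi + 2 pi n and - p half a turn later. The function changes sign in between. *)
Lemma exp_trig_large_zeros e al be : (al != 0) || (be != 0) ->
  forall M, exists2 z, M < z & exp_trig e al be z = 0.
Proof.
move=> H M.
have [phi pn] : exists phi, cos phi *: al + sin phi *: be != 0.
  case/orP: H => H; [exists 0|exists (pi / 2)].
    by rewrite cos0 sin0 scale1r scale0r addr0.
  by rewrite cos_pihalf sin_pihalf scale1r scale0r add0r.
set p := _ + _ in pn.
pose r := cos phi *: (al \Po - 'X) - sin phi *: (be \Po - 'X).
(* A polynomial bound for the terms without exp(zl), by |u| <= u^2 + 1. *)
pose q := (2 *: e) ^+ 2 + 1 + (r ^+ 2 + 1).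
have [s [M1 [s1 h]]] := poly_expR_dominates p q pn.
pose n := Num.bound `|Num.max (Num.max M M1) 0 * l - phi|.
pose x0 := phi + pi *+ 2 *+ n.
have nx : Num.max (Num.max M M1) 0 * l < x0.
  rewrite -ltrBlDl; apply: (le_lt_trans (ler_norm _)).
  apply: (lt_le_trans (archi_boundP (normr_ge0 _))).
  rewrite -/n -[leRHS]mulr_natr ler_peMl ?ler0n //.
  by rewrite mulr2n; have := pi_ge2 R; lra.
have [Mx0 M1x0 x00] : [/\ M < x0 / l, M1 < x0 / l & 0 < x0 / l].
  by move: nx; rewrite -ltr_pdivlMr // !gt_max => /andP[/andP[]].
have x01 : x0 / l < (x0 + pi) / l by rewrite ltr_pM2r ?invr_gt0 // ltrDl pi_gt0.
have cx0 : cos x0 = cos phi by rewrite /x0 (periodicn (@cosD2pi R)).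
have sx0 : sin x0 = sin phi by rewrite /x0 (periodicn (@sinD2pi R)).
have hq z t : 0 < z -> `|t| <= expR (- (z * l)) ->
    `|2 * e.[z] + r.[z] * t| <= q.[z] /\ `|- (2 * e.[z] + r.[z] * t)| <= q.[z].
  move=> z0 ht; rewrite normrN; suff : `|2 * e.[z] + r.[z] * t| <= q.[z] by [].
  have t1 : `|t| <= 1.
    apply: (le_trans ht); rewrite -expR0 ler_expR oppr_le0.
    by rewrite mulr_ge0 // ltW.
  have -> : q.[z] = (2 * e.[z]) ^+ 2 + 1 + (r.[z] ^+ 2 + 1).
    by rewrite /q !hornerE.
  apply: (le_trans (ler_normD _ _)).
  have sq (u : R) : `|u| <= u ^+ 2 + 1.
    by rewrite -real_normK ?num_real //; have := normr_ge0 u; nra.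
  apply: lerD; first exact: sq.
  apply: (le_trans _ (sq _)).
  by rewrite normrM ler_piMr.
have hE (u : R) : `|expR u| <= expR u by rewrite ger0_norm ?expR_ge0.
have hE' (u : R) : `|- expR u| <= expR u by rewrite normrN.
have v0 : 0 < s * exp_trig e al be (x0 / l).
  have [h0 _] := hq _ (expR (- (x0 / l * l))) x00 (hE _).
  have := h _ _ M1x0 h0; congr (0 < s * _).
  rewrite /exp_trig !divfK ?gt_eqF // cx0 sx0 /p /r.
  by rewrite !(hornerD, hornerN, hornerZ, horner_comp, hornerX); ring.
have v1 : 0 < s * - exp_trig e al be ((x0 + pi) / l).
  have [_ h0] := hq _ (- expR (- ((x0 + pi) / l * l)))
    (lt_trans x00 x01) (hE' _).
  have := h _ _ (lt_trans M1x0 x01) h0; congr (0 < s * _).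
  rewrite /exp_trig !divfK ?gt_eqF // cosDpi sinDpi cx0 sx0 /p /r.
  by rewrite !(hornerD, hornerN, hornerZ, horner_comp, hornerX); ring.
have [] := @IVT R (exp_trig e al be) (x0 / l) ((x0 + pi) / l) 0 (ltW x01).
- by apply: continuous_subspaceT; exact: continuous_exp_trig.
- have : 0 < s * exp_trig e al be (x0 / l) *
      (s * - exp_trig e al be ((x0 + pi) / l)).
    exact: mulr_gt0.
  rewrite mulrACA -expr2 s1 mul1r mulrN oppr_gt0.
  move: (exp_trig _ _ _ _) (exp_trig _ _ _ _) => u v uv.
  rewrite ge_min le_max; have [u0|u0] := lerP u 0; have [v0'|v0'] := lerP v 0.
  - by have := lt_le_trans uv (mulr_le0 v0' u0); rewrite ltxx.
  - by rewrite (ltW v0') orbT.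
  - by rewrite (ltW u0) orbT.
  - by have := lt_trans uv (mulr_gt0 v0' u0); rewrite ltxx.
- move=> z; rewrite in_itv /= => /andP[z0 _] fz; exists z => //.
  exact: lt_le_trans z0.
Qed.
Definition ecoefs (a : nat -> R) : seq R :=
  [:: cCC a; 0; 0; 0; cCF a; 0; 0; 0; cFF a].
Definition acoefs (a : nat -> R) : seq R :=
  [:: - cCC a; - cCP a; 0; cCS a; 2 * cY a - cCF a; - cPF a; 0; cSF a; - cFF a].
Definition bcoefs (a : nat -> R) : seq R :=
  [:: 0; cCP a; 2 * cPP a; cCS a; 0; cPF a; 2 * cSS a; cSF a].

(** This is 4 z^4 times the characteristic determinant at s = z^2, see [char_det_real]. *)
Definition exp_trig_of (a : nat -> R) :=
  exp_trig (Poly (ecoefs a)) (Poly (acoefs a)) (Poly (bcoefs a)).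

(* Eliminating exp(zl) between the two equations shows that J = al' be - al be'
   satisfies |J sin|, |J cos| <= polynomial * exp(-zl) at the common zeros; once
   J = 0 the same elimination bounds q and r. *)
Lemma common_zeros e e' al al' be be' p q r :
  (forall z, p.[z] = al'.[z] * be.[z] - al.[z] * be'.[z]) ->
  (forall z, q.[z] = al'.[z] * e.[z] - al.[z] * e'.[z]) ->
  (forall z, r.[z] = be'.[z] * e.[z] - be.[z] * e'.[z]) ->
  (forall M, exists z,
    [/\ M < z, exp_trig e al be z = 0 & exp_trig e' al' be' z = 0]) ->
  [/\ p = 0, q = 0 & r = 0].
Proof.
move=> pE qE rE H.
have [ab [bb [cb [db key]]]] : exists ab bb cb db : {poly R}, forall z,
  exp_trig e al be z = 0 -> exp_trig e' al' be' z = 0 ->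
  2 * q.[z] + p.[z] * sin (z * l) * expR (z * l) +
    (ab.[z] * cos (z * l) - bb.[z] * sin (z * l)) * expR (- (z * l)) = 0 /\
  2 * r.[z] - p.[z] * cos (z * l) * expR (z * l) +
    (cb.[z] * cos (z * l) - db.[z] * sin (z * l)) * expR (- (z * l)) = 0.
  (* The first identity is al' times the first equation minus al times the second; the other one
     uses be' and be. The witnesses collect the terms in exp(-zl). *)
  exists (al' * (al \Po - 'X) - al * (al' \Po - 'X)).
  exists (al' * (be \Po - 'X) - al * (be' \Po - 'X)).
  exists (be' * (al \Po - 'X) - be * (al' \Po - 'X)).
  exists (be' * (be \Po - 'X) - be * (be' \Po - 'X)) => z.
  rewrite /exp_trig pE qE rE.
  rewrite !(hornerD, hornerM, hornerN, horner_comp, hornerX) => h h'; split.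
    transitivity (al'.[z] * 0 - al.[z] * 0); last by rewrite !mulr0 subr0.
    by rewrite -{1}h -h'; ring.
  transitivity (be'.[z] * 0 - be.[z] * 0); last by rewrite !mulr0 subr0.
  by rewrite -{1}h -h'; ring.
have sq (u : R) : `|u| <= u ^+ 2 + 1.
  by rewrite -real_normK ?num_real //; have := normr_ge0 u; nra.
have c1 (u : R) : `|cos u| <= 1 by rewrite ler_norml cos_geN1 cos_le1.
have s1 (u : R) : `|sin u| <= 1 by rewrite ler_norml sin_geN1 sin_le1.
have bd (u v : {poly R}) z : `|u.[z] * cos (z * l) - v.[z] * sin (z * l)| <=
    (u.[z] ^+ 2 + 1) + (v.[z] ^+ 2 + 1).
  rewrite (le_trans (ler_normB _ _)) // lerD // normrM.
    by rewrite (le_trans _ (sq _)) // ler_piMr.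
  by rewrite (le_trans _ (sq _)) // ler_piMr.
have En z : 0 < z -> `|expR (- (z * l))| <= 1.
  move=> z0; rewrite ger0_norm ?expR_ge0 // -expR0 ler_expR oppr_le0.
  by rewrite mulr_ge0 // ltW.
have hb (u w y B : R) : `|w| <= B -> `|y| <= 1 ->
    `|u + w * y| <= u ^+ 2 + 1 + B.
  move=> wB y1; rewrite (le_trans (ler_normD _ _)) // lerD // normrM.
  by rewrite (le_trans _ wB) // ler_piMr.
have p0 : p = 0.
  apply: (poly_eq0_of_expR _ ((2 *: q) ^+ 2 + (ab ^+ 2 + bb ^+ 2) +
    (2 *: r) ^+ 2 + (cb ^+ 2 + db ^+ 2) + 6%:P)) => M.
  have [z [Mz h h']] := H (Num.max M 0).
  move: Mz; rewrite gt_max => /andP[Mz z0]; exists z => //.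
  have [k1 k2] := key z h h'.
  rewrite !(hornerD, hornerZ, horner_exp, hornerC).
  set X := expR (z * l) in k1 k2 *; set Y := expR _ in k1 k2.
  have ps : `|p.[z] * sin (z * l)| * X <=
      (2 * q.[z]) ^+ 2 + (ab.[z] ^+ 2 + bb.[z] ^+ 2) + 3.
    have -> : `|p.[z] * sin (z * l)| * X = `|p.[z] * sin (z * l) * X|.
      by rewrite [RHS]normrM (gtr0_norm (expR_gt0 _)).
    have -> : p.[z] * sin (z * l) * X = - (2 * q.[z] +
        (ab.[z] * cos (z * l) - bb.[z] * sin (z * l)) * Y) by clear -k1; lra.
    rewrite normrN.
    rewrite (le_trans (hb _ _ _ _ (bd _ _ _) (En z z0))) //; clear; lra.
  have pc : `|p.[z] * cos (z * l)| * X <=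
      (2 * r.[z]) ^+ 2 + (cb.[z] ^+ 2 + db.[z] ^+ 2) + 3.
    have -> : `|p.[z] * cos (z * l)| * X = `|p.[z] * cos (z * l) * X|.
      by rewrite [RHS]normrM (gtr0_norm (expR_gt0 _)).
    have -> : p.[z] * cos (z * l) * X = 2 * r.[z] +
        (cb.[z] * cos (z * l) - db.[z] * sin (z * l)) * Y by clear -k2; lra.
    rewrite (le_trans (hb _ _ _ _ (bd _ _ _) (En z z0))) //; clear; lra.
  (* The bounds for p sin and p cos give one for p, since |sin| + |cos| >= 1. *)
  apply: le_trans (le_trans (lerD ps pc) _); last by clear; lra.
  rewrite -mulrDl ler_pM2r ?expR_gt0 // !normrM -mulrDr ler_peMr //.
  have e1 : `|cos (z * l)| ^+ 2 + `|sin (z * l)| ^+ 2 = 1.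
    by rewrite !real_normK ?num_real // cos2Dsin2.
  have := c1 (z * l); have := s1 (z * l).
  have := normr_ge0 (cos (z * l)); have := normr_ge0 (sin (z * l)).
  by move: `|cos _| `|sin _| e1; clear=> c s; nra.
split=> //.
all: have z2 : 2 != 0 :> R by [].
  apply: (scalerI z2); rewrite scaler0.
  apply: (poly_eq0_of_expR _ (ab ^+ 2 + bb ^+ 2 + 2%:P)) => M.
  have [z [Mz h h']] := H M; exists z => //.
  have [k1 _] := key z h h'.
  rewrite !(hornerD, hornerZ, horner_exp, hornerC).
  move: k1; rewrite p0 horner0 !mul0r addr0 => /eqP.
  rewrite addr_eq0 => /eqP ->; rewrite normrN normrM.
  rewrite -mulrA (ger0_norm (expR_ge0 _)) -expRD addNr expR0 mulr1.
  by rewrite (le_trans (bd _ _ _)) //; clear; lra.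
apply: (scalerI z2); rewrite scaler0.
apply: (poly_eq0_of_expR _ (cb ^+ 2 + db ^+ 2 + 2%:P)) => M.
have [z [Mz h h']] := H M; exists z => //.
have [_ k1] := key z h h'.
rewrite !(hornerD, hornerZ, horner_exp, hornerC).
move: k1; rewrite p0 horner0 !mul0r subr0 => /eqP.
rewrite addr_eq0 => /eqP ->; rewrite normrN normrM.
rewrite -mulrA (ger0_norm (expR_ge0 _)) -expRD addNr expR0 mulr1.
by rewrite (le_trans (bd _ _ _)) //; clear; lra.
Qed.

Lemma syzygies_of_common_zeros (a ta : nat -> R) : nondegenerate a ->
  (forall z, 0 < z -> exp_trig_of a z = 0 -> exp_trig_of ta z = 0) ->
  syzygies a ta.
Proof.
move=> na H.
(* If al = be = 0, then 2 cY - cCF = 0, minus a sum of nonnegative terms, gives cY = 0; with the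
   vanishing of the other coefficients, cFF included, this contradicts nondegeneracy. *)
have nz : (Poly (acoefs a) != 0) || (Poly (bcoefs a) != 0).
  rewrite -negb_and; apply/negP => /andP[/eqP za /eqP zb].
  have ca i : (acoefs a)`_i = 0 by rewrite -coef_Poly za coef0.
  have cb i : (bcoefs a)`_i = 0 by rewrite -coef_Poly zb coef0.
  have /= b1 := cb 1%N; have /= b2 := cb 2%N; have /= b3 := cb 3%N.
  have /= b5 := cb 5%N; have /= b6 := cb 6%N; have /= b7 := cb 7%N.
  have /= a0 := ca 0%N; have /= a4 := ca 4%N; have /= a8 := ca 8%N.
  have Y0 : cY a = 0.
    have eF : 2 * cY a - cCF a = - (a 1%N * a 2%N * a 7%N * a 8%N +
      a 3%N * a 4%N * a 5%N * a 6%N + 2 * (a 1%N * a 3%N * a 6%N * a 8%N +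
      a 2%N * a 4%N * a 5%N * a 7%N)) by rewrite /cY /cCF /qA1 /qB1; ring.
    have eY : cY a = - (a 1%N * a 2%N * a 7%N * a 8%N +
      a 3%N * a 4%N * a 5%N * a 6%N + (a 1%N * a 3%N * a 6%N * a 8%N +
      a 2%N * a 4%N * a 5%N * a 7%N)) by rewrite /cY /qA1 /qB1; ring.
    rewrite a4 in eF; have [ha _ _ _ _] := na.
    have h i j k m : (0 < i <= 8)%N -> (0 < j <= 8)%N -> (0 < k <= 8)%N ->
      (0 < m <= 8)%N -> 0 <= a i * a j * a k * a m.
      by move=> *; rewrite !mulr_ge0 ?ha.
    have h1 := h 1%N 2%N 7%N 8%N isT isT isT isT.
    have h2 := h 3%N 4%N 5%N 6%N isT isT isT isT.
    have h3 := h 1%N 3%N 6%N 8%N isT isT isT isT.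
    have h4 := h 2%N 4%N 5%N 7%N isT isT isT isT.
    by apply/eqP; rewrite eq_le eY; apply/andP; split;
      clear -h1 h2 h3 h4 eF; lra.
  have /eqP[] : cFF a != 0 by
    apply: nondegenerate_neq0 => //; split; clear -b1 b2 b3 b5 b6 b7 a0 a8; lra.
  by clear -a8; lra.
have [||||p0 q0 r0] := common_zeros (Poly (ecoefs a)) (Poly (ecoefs ta))
  (Poly (acoefs a)) (Poly (acoefs ta)) (Poly (bcoefs a)) (Poly (bcoefs ta))
  (Poly (Jcoefs a ta)) (Poly (Wcoefs a ta)) (Poly (Ucoefs a ta)).
- by move=> z; rewrite !horner_Poly /= /wedge; ring.
- by move=> z; rewrite !horner_Poly /= /wedge; ring.
- by move=> z; rewrite !horner_Poly /= /wedge; ring.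
- move=> M.
  have [z] := exp_trig_large_zeros (Poly (ecoefs a)) _ _ nz (Num.max M 0).
  rewrite gt_max => /andP[Mz z0] zz; exists z; split=> //.
  exact: H.
by split=> i; rewrite -coef_Poly ?p0 ?q0 ?r0 coef0.
Qed.

End Asymptotics.

(** * Fundamental solutions *)

Section ComplexDerivative.
Context {R : realType}.
Local Notation C := R[i].
Implicit Types (f g : R -> C) (x : R).

Definition is_cderive f x (d : C) :=
  is_derive x (1 : R) (fun t => complex.Re (f t)) (complex.Re d) /\
  is_derive x (1 : R) (fun t => complex.Im (f t)) (complex.Im d).

Lemma ReM (u v : C) : complex.Re (u * v) =
  complex.Re u * complex.Re v - complex.Im u * complex.Im v.
Proof. by case: u v => [? ?] []. Qed.

Lemma ImM (u v : C) : complex.Im (u * v) =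
  complex.Re u * complex.Im v + complex.Im u * complex.Re v.
Proof. by case: u v => [? ?] []. Qed.

Lemma ReD (u v : C) : complex.Re (u + v) = complex.Re u + complex.Re v.
Proof. by case: u v => [? ?] []. Qed.

Lemma ImD (u v : C) : complex.Im (u + v) = complex.Im u + complex.Im v.
Proof. by case: u v => [? ?] []. Qed.

Lemma ReN (u : C) : complex.Re (- u) = - complex.Re u.
Proof. by case: u. Qed.

Lemma ImN (u : C) : complex.Im (- u) = - complex.Im u.
Proof. by case: u. Qed.

Lemma complex_inj (u v : C) : complex.Re u = complex.Re v ->
  complex.Im u = complex.Im v -> u = v.
Proof. by case: u v => [? ?] [? ?] /= -> ->. Qed.

Lemma is_cderiveP f x : cderivable f x -> is_cderive f x (cderive1 f x).
Proof.
by case=> h1 h2; split; rewrite /cderive1 /= derive1E; exact: derivableP.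
Qed.

Lemma is_cderiveD f g x df dg : is_cderive f x df -> is_cderive g x dg ->
  is_cderive (fun t => f t + g t) x (df + dg).
Proof.
move=> [f1 f2] [g1 g2]; split.
  under eq_fun do rewrite ReD.
  by rewrite ReD; exact: is_deriveD.
under eq_fun do rewrite ImD.
by rewrite ImD; exact: is_deriveD.
Qed.

Lemma is_cderiveM f g x df dg : is_cderive f x df -> is_cderive g x dg ->
  is_cderive (fun t => f t * g t) x (df * g x + f x * dg).
Proof.
move=> [f1 f2] [g1 g2]; split.
  under eq_fun do rewrite ReM.
  rewrite ReD !ReM; apply: is_derive_eq.
  by rewrite /GRing.scale /=; ring.
under eq_fun do rewrite ImM.
rewrite ImD !ImM; apply: is_derive_eq.
by rewrite /GRing.scale /=; ring.
Qed.

Lemma is_cderive_cst (c : C) x : is_cderive (fun=> c) x 0.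
Proof. by split; exact: is_derive_cst. Qed.

Lemma is_cderive_reflect f (l : R) x d : is_cderive f (l - x) d ->
  is_cderive (fun t => f (l - t)) x (- d).
Proof.
have h : is_derive x (1 : R) (fun t => l - t) (- 1).
  by rewrite -[- 1]add0r; exact: is_deriveB.
move=> [f1 f2]; split.
  rewrite ReN -mulrN1.
  exact: (@is_derive1_comp _ (fun t => complex.Re (f t)) (fun t => l - t)).
rewrite ImN -mulrN1.
exact: (@is_derive1_comp _ (fun t => complex.Im (f t)) (fun t => l - t)).
Qed.

Lemma is_cderive0_cst f (x y : R) : (forall t, is_cderive f t 0) -> f x = f y.
Proof.
move=> h; apply: complex_inj.
  by apply: (is_derive_0_is_cst (f := fun t => complex.Re (f t))) => t;
    case: (h t).
by apply: (is_derive_0_is_cst (f := fun t => complex.Im (f t))) => t;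
  case: (h t).
Qed.

(* [F k] stands for the [k]-th derivative of a solution. *)
Definition jet (mu : C) (F : nat -> R -> C) :=
  (forall k x, is_cderive (F k) x (F k.+1 x)) /\
  (forall k x, F (k + 4)%N x = mu * F k x).

Lemma jet_shift mu F r : jet mu F -> jet mu (fun k => F (r + k)%N).
Proof.
by case=> h1 h2; split=> k x; [rewrite addnS|rewrite addnA].
Qed.

(** A solution is expressed by its four initial values: this replaces a uniqueness theorem when
    solutions are identified below. *)
Lemma jet_concomitant mu F G (l : R) : jet mu F -> jet mu G ->
  G 0%N 0 = 0 -> G 1%N 0 = 0 -> G 2%N 0 = 0 -> G 3%N 0 = 1 ->
  F 0%N l = F 3%N 0 * G 0%N l + F 2%N 0 * G 1%N l + F 1%N 0 * G 2%N l +
    F 0%N 0 * G 3%N l.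
Proof.
move=> [F1 F2] [G1 G2] g0 g1 g2 g3.
(* The concomitant of F and of the reflection of G is constant. *)
pose W t := F 3%N t * G 0%N (l - t) + F 2%N t * G 1%N (l - t) +
  F 1%N t * G 2%N (l - t) + F 0%N t * G 3%N (l - t).
have : W 0 = W l.
  apply: is_cderive0_cst => t.
  have d i j := is_cderiveM _ _ _ _ _ (F1 i t)
    (is_cderive_reflect _ l t _ (G1 j (l - t))).
  have := is_cderiveD _ _ _ _ _ (is_cderiveD _ _ _ _ _
    (is_cderiveD _ _ _ _ _ (d 3 0) (d 2 1)) (d 1 2)) (d 0 3).
  have -> : F 4 t = mu * F 0%N t by exact: (F2 0%N).
  have -> : G 4 (l - t) = mu * G 0%N (l - t) by exact: (G2 0%N).
  by congr is_cderive; rewrite !mulrN; ring.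
rewrite /W subrr subr0 g0 g1 g2 g3.
by rewrite !mulr0 !add0r mulr1 => <-.
Qed.

(** [ode_solution] provides derivatives up to order four only; the equation supplies the others,
    order 4q + r being mu^q times order r. *)
Definition shifted_jet (mu : C) (f : R -> C) (k : nat) (x : R) :=
  mu ^+ (k %/ 4) * cderiven (k %% 4) f x.

Lemma jet_ode_solution s f :
  ode_solution s f -> jet (s ^+ 2) (shifted_jet (s ^+ 2) f).
Proof.
move=> [f1 f2]; split=> k x; last first.
  rewrite /shifted_jet divnDr // modnDr addn1 exprS mulrA.
  by [].
have cM (c d : C) (g : R -> C) : is_cderive g x d ->
    is_cderive (fun t => c * g t) x (c * d).
  move=> h; have := is_cderiveM _ _ _ _ _ (is_cderive_cst c x) h.
  by rewrite mul0r add0r.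
have k4 : (k %% 4 < 4)%N by rewrite ltn_mod.
have := cM (s ^+ 2 ^+ (k %/ 4)) _ _ (is_cderiveP _ _ (f1 _ x k4)).
congr is_cderive; rewrite /shifted_jet.
rewrite -[cderive1 _ _]/(cderiven (k %% 4).+1 f x).
have [q m] : (k.+1 %/ 4 = k %/ 4 + (k %% 4).+1 %/ 4 /\
    k.+1 %% 4 = (k %% 4).+1 %% 4)%N.
  have e : k.+1 = (k %/ 4 * 4 + (k %% 4).+1)%N by rewrite addnS -divn_eq.
  by split; rewrite {1}e ?divnMDl ?modnMDl.
(* The quotient by 4 grows only when the remainder is 3, and there the equation is used. *)
rewrite q m; have [e|e] := eqVneq (k %% 4)%N 3%N.
  by rewrite e divnn modnn addn1 f2 mulrA -exprSr.
have e4 : ((k %% 4).+1 < 4)%N.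
  by rewrite ltn_neqAle k4 andbT eqSS.
by rewrite (divn_small e4) (modn_small e4) addn0.
Qed.

End ComplexDerivative.

(** * Power series solutions and their dependence on s *)

Section ExponentialGeneratingFunctions.
Context {R : realType}.
Local Notation C := R[i].
Local Notation normc := (@ComplexField.Normc.normc R).
Implicit Types (t u : nat -> R) (tau sigma : nat -> C) (x : R).

Definition egf t x := limn (pseries (fun k => t k / k`!%:R) x).

Definition exp_bounded t :=
  exists K B : R, 0 <= B /\ forall k, `|t k| <= K * B ^+ k.

Lemma egf_term_le t K B x : 0 <= B -> (forall k, `|t k| <= K * B ^+ k) ->
  forall k, `|t k / k`!%:R * x ^+ k| <= K * (exp_coeff (B * `|x|) k).
Proof.
move=> B0 h k; rewrite /exp_coeff /= !normrM normrX normfV normr_nat exprMn.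
rewrite (_ : K * _ = K * B ^+ k * k`!%:R^-1 * `|x| ^+ k); last by ring.
by rewrite !ler_wpM2r ?exprn_ge0 // invr_ge0.
Qed.

Lemma egf_cvg_norm t x : exp_bounded t ->
  cvgn [normed pseries (fun k => t k / k`!%:R) x].
Proof.
move=> [K [B [B0 h]]]; have hh := egf_term_le _ _ _ x B0 h.
apply: (series_le_cvg _ _ hh) => [k|k|]; first exact: normr_ge0.
  exact: le_trans (hh k).
by have /(_ K) := is_cvg_seriesZ (is_cvg_series_exp_coeff (B * `|x|)).
Qed.

Lemma egf_cvg t x : exp_bounded t -> cvgn (pseries (fun k => t k / k`!%:R) x).
Proof. by move=> h; apply: normed_cvg; exact: egf_cvg_norm. Qed.

Lemma egf_norm_le t K B x : 0 <= B -> (forall k, `|t k| <= K * B ^+ k) ->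
  `|egf t x| <= K * expR (B * `|x|).
Proof.
move=> B0 h; have bt : exp_bounded t by exists K, B.
have cn := egf_cvg_norm _ x bt; apply: (le_trans (lim_series_norm cn)).
have ce := is_cvg_series_exp_coeff (B * `|x|).
rewrite /expR -[leRHS](lim_seriesZ K ce); apply: lim_series_le => //.
  exact: is_cvg_seriesZ.
exact: egf_term_le.
Qed.

Lemma egfD t u x : exp_bounded t -> exp_bounded u ->
  egf (fun k => t k + u k) x = egf t x + egf u x.
Proof.
move=> ht hu; rewrite /egf -lim_seriesD; [|exact: egf_cvg..].
congr (limn (series _)); apply/funext => k /=.
transitivity (t k / k`!%:R * x ^+ k + u k / k`!%:R * x ^+ k); last by [].
by rewrite !mulrDl.
Qed.

Lemma egfZ a t x : exp_bounded t -> egf (fun k => a * t k) x = a * egf t x.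
Proof.
move=> ht; rewrite /egf -[RHS](lim_seriesZ a); last exact: egf_cvg.
congr (limn (series _)); apply/funext => k /=.
transitivity (a * (t k / k`!%:R * x ^+ k)); last by [].
by rewrite !mulrA.
Qed.

Lemma egf0 t : egf t 0 = t 0%N.
Proof.
rewrite /egf /pseries; apply: lim_near_cst => //; exists 1%N => // n /= n1.
rewrite /series /= big_ltn // big_nat big1 ?addr0.
  by rewrite fact0 expr0 divr1 mulr1.
by move=> i /andP[i0 _]; rewrite expr0n (gtn_eqF i0) mulr0.
Qed.

Lemma exp_bounded_shift t : exp_bounded t -> exp_bounded (fun k => t k.+1).
Proof.
move=> [K [B [B0 h]]]; exists (K * B), B; split=> // k.
by rewrite -mulrA -exprS.
Qed.

Lemma is_derive_egf t x : exp_bounded t ->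
  is_derive x (1 : R) (egf t) (egf (fun k => t k.+1) x).
Proof.
have dE u : pseries_diffs (fun k => u k / k`!%:R) = (fun k => u k.+1 / k`!%:R).
  apply/funext => k; rewrite /pseries_diffs factS natrM.
  by rewrite mulrCA invfM mulVKf.
move=> ht; have := @pseries_snd_diffs R (fun k => t k / k`!%:R) (`|x| + 1) x.
rewrite !dE; apply.
- exact: egf_cvg.
- exact: (egf_cvg _ _ (exp_bounded_shift _ ht)).
- exact: (egf_cvg _ _ (exp_bounded_shift _ (exp_bounded_shift _ ht))).
- by rewrite [ltRHS]ger0_norm ?addr_ge0 // ltrDl.
Qed.

Definition cegf tau x : C :=
  @Complex R (egf (fun k => complex.Re (tau k)) x)
    (egf (fun k => complex.Im (tau k)) x).

Definition cexp_bounded tau K B :=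
  0 <= B /\ forall k, normc (tau k) <= K * B ^+ k.

Lemma Re_le_normc (z : C) : `|complex.Re z| <= normc z.
Proof.
case: z => a b; rewrite /ComplexField.Normc.normc /= -sqrtr_sqr.
by rewrite ler_wsqrtr // lerDl sqr_ge0.
Qed.

Lemma Im_le_normc (z : C) : `|complex.Im z| <= normc z.
Proof.
case: z => a b; rewrite /ComplexField.Normc.normc /= -[leLHS]sqrtr_sqr.
by rewrite ler_wsqrtr // lerDr sqr_ge0.
Qed.

Lemma normc_le_ReIm (z : C) : normc z <= `|complex.Re z| + `|complex.Im z|.
Proof.
case: z => a b; rewrite /ComplexField.Normc.normc /=.
rewrite -[leRHS]ger0_norm ?addr_ge0 // -sqrtr_sqr ler_wsqrtr // sqrrD.
by rewrite !real_normK ?num_real // lerD2r lerDl mulrn_wge0 ?mulr_ge0.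
Qed.

Lemma cexp_boundedRe tau K B : cexp_bounded tau K B ->
  exp_bounded (fun k => complex.Re (tau k)).
Proof.
by case=> B0 h; exists K, B; split=> // k; exact: le_trans (Re_le_normc _) _.
Qed.

Lemma cexp_boundedIm tau K B : cexp_bounded tau K B ->
  exp_bounded (fun k => complex.Im (tau k)).
Proof.
by case=> B0 h; exists K, B; split=> // k; exact: le_trans (Im_le_normc _) _.
Qed.

Lemma cegf_norm_le tau K B x : cexp_bounded tau K B ->
  normc (cegf tau x) <= 2 * K * expR (B * `|x|).
Proof.
move=> [B0 h]; apply: (le_trans (normc_le_ReIm _)).
rewrite -mulrA mulr_natl mulr2n; apply: lerD; apply: egf_norm_le => // k.
  exact: le_trans (Re_le_normc _) _.
exact: le_trans (Im_le_normc _) _.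
Qed.

Lemma cegfD tau sigma K B K' B' x :
  cexp_bounded tau K B -> cexp_bounded sigma K' B' ->
  cegf (fun k => tau k + sigma k) x = cegf tau x + cegf sigma x.
Proof.
move=> h h'; apply: complex_inj.
  rewrite ReD /= -egfD; [|exact: cexp_boundedRe h|exact: cexp_boundedRe h'].
  by congr (egf _ x); apply/funext => k; rewrite ReD.
rewrite ImD /= -egfD; [|exact: cexp_boundedIm h|exact: cexp_boundedIm h'].
by congr (egf _ x); apply/funext => k; rewrite ImD.
Qed.

Lemma exp_boundedZ a t : exp_bounded t -> exp_bounded (fun k => a * t k).
Proof.
move=> [K [B [B0 h]]]; exists (`|a| * K), B; split=> // k.
by rewrite normrM -mulrA ler_wpM2l.
Qed.

Lemma cegfZ c tau K B x : cexp_bounded tau K B ->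
  cegf (fun k => c * tau k) x = c * cegf tau x.
Proof.
move=> h; have hR := cexp_boundedRe _ _ _ h; have hI := cexp_boundedIm _ _ _ h.
apply: complex_inj.
  rewrite ReM /= -mulNr -!egfZ // -egfD; [|exact: exp_boundedZ..].
  by congr (egf _ x); apply/funext => k; rewrite ReM mulNr.
rewrite ImM /= -!egfZ // -egfD; [|exact: exp_boundedZ..].
by congr (egf _ x); apply/funext => k; rewrite ImM.
Qed.

Lemma cegf0 tau : cegf tau 0 = tau 0%N.
Proof. by apply: complex_inj; rewrite /= egf0. Qed.

Lemma is_cderive_cegf tau K B x : cexp_bounded tau K B ->
  is_cderive (cegf tau) x (cegf (fun k => tau k.+1) x).
Proof.
move=> h; split.
  exact: (is_derive_egf _ _ (cexp_boundedRe _ _ _ h)).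
exact: (is_derive_egf _ _ (cexp_boundedIm _ _ _ h)).
Qed.

Lemma normcM (u v : C) : normc (u * v) = normc u * normc v.
Proof. exact: ComplexField.Normc.normcM. Qed.

Lemma normcD (u v : C) : normc (u + v) <= normc u + normc v.
Proof. exact: le_normcD. Qed.

Lemma normc_ge0 (u : C) : 0 <= normc u.
Proof. by case: u => a b; exact: sqrtr_ge0. Qed.

Lemma normcX (u : C) n : normc (u ^+ n) = normc u ^+ n.
Proof.
elim: n => [|n IH]; first by rewrite !expr0 ComplexField.Normc.normc1.
by rewrite !exprS normcM IH.
Qed.

Lemma normcMn (u : C) n : normc (u *+ n) = normc u *+ n.
Proof. exact: complex.normcMn. Qed.

Lemma natr_le_exp2 m : m%:R <= 2 ^+ m :> R.
Proof. by rewrite -natrX ler_nat ltnW // ltn_expl. Qed.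

Lemma pow_deriv_le (z : C) m :
  normc (z ^+ m.-1 *+ m) <= (2 * (1 + normc z)) ^+ m.
Proof.
have z0 := normc_ge0 z; have h : 1 <= 1 + normc z by rewrite lerDl.
rewrite normcMn normcX -(mulr_natl _ m) exprMn.
rewrite ler_pM ?exprn_ge0 ?natr_le_exp2 //.
case: m => [|m] /=; first by rewrite !expr0.
apply: (@le_trans _ _ ((1 + normc z) ^+ m)); last exact: ler_weXn2l.
by rewrite lerXn2r ?nnegrE ?lerDr // (le_trans z0) ?lerDr.
Qed.

(** The bound is geometric in m, so it can be summed over a series. The remainder for m + 1 is (z +
    h) times the one for m, plus h^2 m z^(m-1). *)
Lemma pow_remainder (z h : C) m : normc h <= 1 ->
  normc ((z + h) ^+ m - z ^+ m - h * (z ^+ m.-1 *+ m)) <=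
  normc h ^+ 2 * (2 * (1 + normc z)) ^+ m.
Proof.
move=> h1; have z0 := normc_ge0 z; have h0 := normc_ge0 h.
have r1 : 1 <= 1 + normc z by rewrite lerDl.
have r0 : 0 <= 1 + normc z by apply: le_trans r1.
elim: m => [|m IH].
  rewrite !expr0 mulr0n mulr0 subrr subr0 ComplexField.Normc.normc0.
  by rewrite mulr1 exprn_ge0.
have -> : (z + h) ^+ m.+1 - z ^+ m.+1 - h * (z ^+ m.+1.-1 *+ m.+1) =
    (z + h) * ((z + h) ^+ m - z ^+ m - h * (z ^+ m.-1 *+ m)) +
    h ^+ 2 * (z ^+ m.-1 *+ m).
  case: m {IH} => [|m] /=; first by rewrite !expr1 !expr0 mulr1n; ring.
  by rewrite -(mulr_natl _ m.+2) -(mulr_natl _ m.+1) !exprS -!natr1; ring.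
apply: (le_trans (normcD _ _)).
rewrite (normcM (z + h)) (normcM (h ^+ 2)) (normcX h).
have IH2 := pow_deriv_le z m.
have zh : normc (z + h) <= 1 + normc z.
  by rewrite (le_trans (normcD _ _)) // addrC lerD2r.
set X := (2 * (1 + normc z)) ^+ m in IH IH2 *.
have X0 : 0 <= X by rewrite exprn_ge0 // mulr_ge0.
rewrite (exprS (2 * _)) -/X.
apply: (@le_trans _ _ ((1 + normc z) * (normc h ^+ 2 * X) + normc h ^+ 2 * X)).
  apply: lerD; first by rewrite ler_pM ?normc_ge0.
  by rewrite ler_wpM2l ?exprn_ge0.
have : 0 <= (normc h ^+ 2 * X) * normc z.
  exact: mulr_ge0 (mulr_ge0 (exprn_ge0 _ h0) X0) z0.
by move: (normc h ^+ 2) => H; clear; lra.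
Qed.

Lemma cexp_boundedD tau sigma K B K' B' :
  cexp_bounded tau K B -> cexp_bounded sigma K' B' ->
  cexp_bounded (fun n => tau n + sigma n) (K + K') (B + B').
Proof.
move=> [B0 h] [B0' h']; split=> [|n]; first exact: addr_ge0.
have K0 : 0 <= K.
  by have := le_trans (normc_ge0 _) (h 0%N); rewrite expr0 mulr1.
have K0' : 0 <= K'.
  by have := le_trans (normc_ge0 _) (h' 0%N); rewrite expr0 mulr1.
rewrite (le_trans (normcD _ _)) // mulrDl; apply: lerD.
  by rewrite (le_trans (h n)) // ler_wpM2l // lerXn2r ?nnegrE ?addr_ge0 ?lerDl.
by rewrite (le_trans (h' n)) // ler_wpM2l // lerXn2r ?nnegrE ?addr_ge0 ?lerDr.
Qed.

(** The n-th derivative at 0 of y_4 = sum of s^(2j) x^(4j+3) / (4j+3)!: for n = 4j + 3, [n./2.-1] is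
    2j. *)
Definition sols_coef (s : C) (n : nat) : C :=
  if (n %% 4 == 3)%N then s ^+ n./2.-1 else 0.

(** The derivative of [sols_coef] in s. For n = 3 the truncated exponent is harmless, the multiplier
    being 0. *)
Definition sols_dcoef (s : C) (n : nat) : C :=
  if (n %% 4 == 3)%N then s ^+ n./2.-1.-1 *+ n./2.-1 else 0.

(* [sols s 3], [sols s 2], [sols s 1], [sols s 0] are the fundamental solutions
   y_1, ..., y_4 of y'''' = s^2 y. *)
Definition sols (s : C) (k : nat) (x : R) : C :=
  cegf (fun n => sols_coef s (k + n)%N) x.

Lemma half_pred_le n : (n./2.-1 <= n)%N.
Proof.
rewrite (leq_trans (leq_pred _)) // -{2}(odd_double_half n) -addnn addnA.
exact: leq_addl.
Qed.

Lemma sols_coef_bounded s k : cexp_bounded (fun n => sols_coef s (k + n)%N)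
  ((1 + normc s) ^+ k) (1 + normc s).
Proof.
have s0 := normc_ge0 s; split=> [|n]; first by rewrite addr_ge0.
have h : 1 <= 1 + normc s by rewrite lerDl.
rewrite -exprD /sols_coef; case: ifP => _; last first.
  by rewrite ComplexField.Normc.normc0 exprn_ge0 ?addr_ge0.
rewrite normcX (le_trans _ (ler_weXn2l h (half_pred_le _))) //.
by rewrite lerXn2r ?nnegrE ?lerDr // addr_ge0.
Qed.

Lemma sols_dcoef_bounded s k : cexp_bounded (fun n => sols_dcoef s (k + n)%N)
  ((2 * (1 + normc s)) ^+ k) (2 * (1 + normc s)).
Proof.
have s0 := normc_ge0 s; split=> [|n]; first by rewrite mulr_ge0 ?addr_ge0.
have h : 1 <= 2 * (1 + normc s) by clear -s0; lra.
rewrite -exprD /sols_dcoef; case: ifP => _; last first.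
  by rewrite ComplexField.Normc.normc0 exprn_ge0 ?mulr_ge0 ?addr_ge0.
apply: (le_trans (pow_deriv_le _ _)).
exact: (ler_weXn2l h (half_pred_le _)).
Qed.

Lemma jet_sols s : jet (s ^+ 2) (sols s).
Proof.
split=> k x.
  have := is_cderive_cegf _ _ _ x (sols_coef_bounded s k).
  congr is_cderive; congr (cegf _ x); apply/funext => n.
  by rewrite addnS addSn.
rewrite -(cegfZ _ _ _ _ x (sols_coef_bounded s k)).
congr (cegf _ x); apply/funext => n; rewrite addnAC /sols_coef modnDr.
case: ifP => [k3|_]; last by rewrite mulr0.
rewrite -exprD; congr (s ^+ _).
(* Hence [.-1] is not truncated, and a shift by 4 raises the exponent by exactly 2. *)
have : (0 < (k + n)./2)%N by rewrite half_gt0; case: (k + n)%N k3 => [|[]].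
by case: (k + n)%N => [|[|m]] //= _; rewrite !addn4 /= add2n.
Qed.

Lemma sols_at0 s k : (k < 4)%N -> sols s k 0 = (k == 3)%:R.
Proof.
rewrite /sols cegf0 addn0 /sols_coef.
by case: k => [|[|[|[|]]]] //= _; rewrite expr0.
Qed.

(** At s = 0 only the coefficient with n = 3 survives, because 0^0 = 1, and the series is a
    monomial. *)
Lemma sols_s0 k x : (k < 4)%N -> sols 0 k x = (x ^+ (3 - k) / (3 - k)`!%:R)%:C.
Proof.
move=> k4; have e n : sols_coef 0 n = (n == 3)%:R.
  rewrite /sols_coef; have [->|n3] := eqVneq n 3; first by rewrite /= expr0.
  case: ifP => // /eqP h; rewrite expr0n; case: eqP => // m0.
  by case: n h n3 m0 => [|[|[|[|n]]]].
rewrite /sols; under eq_fun do rewrite e.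
apply: complex_inj => /=.
  rewrite /egf /pseries; apply: lim_near_cst => //; exists 4%N => // n /= n4.
  rewrite /series /= (bigD1_seq (3 - k)%N) ?iota_uniq //=; last first.
    by rewrite mem_index_iota /= (leq_ltn_trans (leq_subr _ _)).
  rewrite subnKC // eqxx mulr1n big1 ?addr0; first by rewrite /= mul1r mulrC.
  move=> i ik; have -> : (k + i == 3)%N = false.
    by apply: contraNF ik => /eqP <-; rewrite addKn.
  by rewrite !mul0r.
rewrite /egf /pseries; apply: lim_near_cst => //; exists 0%N => // n _.
rewrite /series /= big1 // => i _.
by case: (k + i == 3)%N; rewrite !mul0r.
Qed.

Lemma derivable_of_remainder (f : C -> C) (z d : C) (M : R) :
  (forall h, normc h <= 1 ->
    normc (f (z + h) - f z - h * d) <= M * normc h ^+ 2) ->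
  derivable (f : C^o -> C^o) z 1.
Proof.
move=> H; apply/cvg_ex; exists d; apply/(@cvgrPdist_le C C^o) => e e0.
(* A positive element of R[i] is a positive real. *)
have [e' e'0 ee'] : exists2 e' : R, 0 < e' & e'%:C <= e.
  move: e0; rewrite ltcE => /andP[/eqP i0 ?]; exists (complex.Re e) => //.
  by rewrite lecE /= i0 eqxx lexx.
have M1 : 0 < 1 + `|M| by rewrite ltr_wpDr.
pose r := Num.min 1 (e' / (1 + `|M|)).
have r0 : 0 < r by rewrite lt_min ltr01 divr_gt0.
near=> h.
have h0 : h != 0 by near: h; exact: nbhs_dnbhs_neq.
have hr : `|h| <= r%:C.
  near: h; apply: dnbhs0_le; rewrite ltcR //.
have {}hr : normc h <= r by rewrite -lecR.
have hp : 0 < normc h.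
  rewrite lt_neqAle normc_ge0 andbT eq_sym; apply: contraNneq h0.
  by move=> /ComplexField.Normc.eq0_normc ->.
have := H h; move: hr; rewrite le_min => /andP[h1 h2] /(_ h1) hh.
apply: le_trans ee'; rewrite -[X in X <= _]/((normc _)%:C) lecR.
rewrite /= /GRing.scale /= mulr1.
have -> : d - h^-1 * (f (h + z) - f z) = - (h^-1 * (f (z + h) - f z - h * d)).
  by rewrite (addrC h z); field.
have nN (u : C) : normc (- u) = normc u by case: u => ? ? /=; rewrite !sqrrN.
rewrite nN normcM ComplexField.Normc.normcV ler_pdivrMl //.
apply: (le_trans hh).
rewrite ler_pdivlMr // in h2.
rewrite expr2 mulrA mulrC ler_wpM2l ?normc_ge0 //.
apply: le_trans h2; rewrite mulrC ler_wpM2l ?normc_ge0 //.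
by rewrite (le_trans (ler_norm _)) // lerDr.
Unshelve. all: by end_near.
Qed.

(** The series is differentiated termwise in s: [pow_remainder] bounds the coefficients of the
    remainder series, whose sum is O(|h|^2). *)
Lemma entire_sols k x : entire (fun s => sols s k x).
Proof.
move=> z; pose B := 2 * (1 + normc z).
apply: (@derivable_of_remainder _ z (cegf (fun n => sols_dcoef z (k + n)%N) x)
  (2 * B ^+ k * expR (B * `|x|))) => h h1.
pose sg n := sols_coef (z + h) (k + n)%N - sols_coef z (k + n)%N -
  h * sols_dcoef z (k + n)%N.
have b1 := sols_coef_bounded (z + h) k; have b2 := sols_coef_bounded z k.
have b3 := sols_dcoef_bounded z k.
have bN c (u : nat -> C) K B' : cexp_bounded u K B' ->
    cexp_bounded (fun n => c * u n) (normc c * K) B'.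
  case=> B0 hu; split=> // n; rewrite normcM -mulrA ler_wpM2l //.
  exact: normc_ge0.
have bs : cexp_bounded sg (normc h ^+ 2 * B ^+ k) B.
  split; first by rewrite mulr_ge0 // addr_ge0 // normc_ge0.
  move=> n; rewrite /sg /sols_coef /sols_dcoef -mulrA -exprD.
  have B1 : 1 <= B by rewrite /B; have := normc_ge0 z; clear; lra.
  have h0 : 0 <= normc h ^+ 2 by rewrite exprn_ge0 // normc_ge0.
  case: ifP => _; last first.
    rewrite mulr0 !subr0 ComplexField.Normc.normc0 mulr_ge0 // exprn_ge0 //.
    exact: le_trans B1.
  apply: (le_trans (pow_remainder _ _ _ h1)); rewrite ler_wpM2l //.
  exact: (ler_weXn2l B1 (half_pred_le _)).
have -> : sols (z + h) k x - sols z k x -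
    h * cegf (fun n => sols_dcoef z (k + n)%N) x = cegf sg x.
  have -> : sols (z + h) k x = cegf (fun n => sg n + (sols_coef z (k + n)%N +
      h * sols_dcoef z (k + n)%N)) x.
    by congr (cegf _ x); apply/funext => n; rewrite /sg; ring.
  have b4 := bN h _ _ _ b3.
  rewrite (cegfD _ _ _ _ _ _ x bs (cexp_boundedD _ _ _ _ _ _ b2 b4)).
  rewrite (cegfD _ _ _ _ _ _ x b2 b4).
  by rewrite (cegfZ _ _ _ _ x b3) /sols; ring.
apply: (le_trans (cegf_norm_le _ _ _ x bs)).
by rewrite le_eqVlt; apply/orP; left; apply/eqP; ring.
Qed.
End ExponentialGeneratingFunctions.

(** * The characteristic function *)

Section CharacteristicFunction.
Context {R : realType}.
Local Notation C := R[i].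

(** Entries given by a function on pairs of naturals let the minors keep this shape, so that the
    expansion can be iterated. *)
Lemma det_nat_expand n (g : nat -> nat -> C) :
  \det (\matrix_(i < n.+1, j < n.+1) g i j) = \sum_(k < n.+1) g 0%N k *
    ((-1) ^+ k * \det (\matrix_(i < n, j < n) g i.+1 (bump k j))).
Proof.
rewrite (expand_det_row _ ord0); apply: eq_bigr => k _.
rewrite mxE /cofactor add0n; congr (_ * (_ * \det _)).
by apply/matrixP => i j; rewrite !mxE.
Qed.

Lemma det2_nat (g : nat -> nat -> C) :
  \det (\matrix_(i < 2, j < 2) g i j) = g 0 0 * g 1 1 - g 0 1 * g 1 0.
Proof.
rewrite det_nat_expand !big_ord_recl big_ord0 !det_mx11 !mxE /= /bump /=.
by rewrite expr0 expr1; ring.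
Qed.

Lemma det3_nat (g : nat -> nat -> C) :
  \det (\matrix_(i < 3, j < 3) g i j) = g 0 0 * (g 1 1 * g 2 2 - g 1 2 * g 2 1)
  - g 0 1 * (g 1 0 * g 2 2 - g 1 2 * g 2 0)
  + g 0 2 * (g 1 0 * g 2 1 - g 1 1 * g 2 0).
Proof.
rewrite det_nat_expand !big_ord_recl big_ord0.
rewrite !(det2_nat (fun i j => g i.+1 (bump _ j))) /= /bump /=.
by rewrite expr0 expr1 sqrrN expr1n; ring.
Qed.

(** Laplace expansion along the first two rows, which hold the conditions at 0. *)
Lemma det4_nat (g : nat -> nat -> C) :
  \det (\matrix_(i < 4, j < 4) g i j) =
    (g 0 0 * g 1 1 - g 0 1 * g 1 0) * (g 2 2 * g 3 3 - g 2 3 * g 3 2)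
  - (g 0 0 * g 1 2 - g 0 2 * g 1 0) * (g 2 1 * g 3 3 - g 2 3 * g 3 1)
  + (g 0 0 * g 1 3 - g 0 3 * g 1 0) * (g 2 1 * g 3 2 - g 2 2 * g 3 1)
  + (g 0 1 * g 1 2 - g 0 2 * g 1 1) * (g 2 0 * g 3 3 - g 2 3 * g 3 0)
  - (g 0 1 * g 1 3 - g 0 3 * g 1 1) * (g 2 0 * g 3 2 - g 2 2 * g 3 0)
  + (g 0 2 * g 1 3 - g 0 3 * g 1 2) * (g 2 0 * g 3 1 - g 2 1 * g 3 0).
Proof.
rewrite det_nat_expand !big_ord_recl big_ord0.
rewrite !(det3_nat (fun i j => g i.+1 (bump _ j))) /= /bump /=.
by rewrite expr0 expr1 sqrrN expr1n (exprS _ 2) sqrrN expr1n; ring.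
Qed.

(** For initial data S equal to the j-th unit vector, the sum from [jet_concomitant] collapses to
    one term. *)
Lemma select_column (mu : C) (S K : nat -> C) (r j : nat) :
  (r < 4)%N -> (j < 4)%N ->
  (forall k, (k < 4)%N -> S k = (j == k :> nat)%:R) ->
  (forall k, S (k + 4)%N = mu * S k) -> (forall k, K (k + 4)%N = mu * K k) ->
  S (r + 3)%N * K 0%N + S (r + 2)%N * K 1%N + S (r + 1)%N * K 2%N +
    S r * K 3%N = K (3 + r - j)%N.
Proof.
move=> r4 j4 S0 S4 K4.
have e0 := S0 0 isT; have e1 := S0 1 isT; have e2 := S0 2 isT.
have e3 := S0 3 isT.
have e4 : S 4 = mu * S 0%N by exact: (S4 0).
have e5 : S 5 = mu * S 1%N by exact: (S4 1).
have e6 : S 6 = mu * S 2%N by exact: (S4 2).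
have k4 : K 4 = mu * K 0%N by exact: (K4 0).
have k5 : K 5 = mu * K 1%N by exact: (K4 1).
have k6 : K 6 = mu * K 2%N by exact: (K4 2).
have z : mu * 0 = 0 by exact: mulr0.
have o : mu * 1 = mu by exact: mulr1.
case: r r4 => [|[|[|[|//]]]] _; case: j j4 S0 e0 e1 e2 e3 => [|[|[|[|//]]]] _ _
  /= e0 e1 e2 e3;
  by rewrite /= ?(e4, e5, e6) ?(e0, e1, e2, e3) ?(z, o) ?(mul0r, mul1r)
    ?(add0r, addr0).
Qed.

(** By the representation through initial values, any given fundamental system consists of
    derivatives of y_4. *)
Lemma fundamental_system_at (s : C) (f : 'I_4 -> R -> C) (l : R)
    (j : 'I_4) (r : nat) : fundamental_system s f -> (r < 4)%N ->
  cderiven r (f j) l = sols s (3 + r - j)%N l.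
Proof.
move=> /(_ j); move: (f j) => {}f [/jet_ode_solution jf f0] r4.
have -> : cderiven r f l = shifted_jet (s ^+ 2) f r l.
  by rewrite /shifted_jet divn_small // modn_small // mul1r.
have js := jet_sols s.
have := jet_concomitant _ _ _ l (jet_shift _ _ r jf) js (sols_at0 s 0 isT)
  (sols_at0 s 1 isT) (sols_at0 s 2 isT) (sols_at0 s 3 isT).
rewrite addn0 => ->.
apply: (select_column (s ^+ 2) (fun k => shifted_jet (s ^+ 2) f k 0)
  (fun k => sols s k l)) => // [k k4|k|k].
- by rewrite /shifted_jet divn_small // modn_small // mul1r (f0 (Ordinal k4)).
- by rewrite (proj2 jf).
- by rewrite (proj2 js).
Qed.

Lemma real_complexM (u v : R) : (u * v)%:C = u%:C * v%:C :> C.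
Proof. exact: rmorphM. Qed.

Lemma real_complexD (u v : R) : (u + v)%:C = u%:C + v%:C :> C.
Proof. exact: rmorphD. Qed.

Lemma real_complexN (u : R) : (- u)%:C = - u%:C :> C.
Proof. exact: rmorphN. Qed.

(** The arguments k0, ..., k3 stand for y_4 and its first three derivatives at l. Each bracket is,
    up to sign and a power of mu, the determinant for the end conditions that its coefficient names;
    [cY - cCF] is the coefficient PS. *)
Definition charfun (a : nat -> R) (mu k0 k1 k2 k3 : C) : C :=
  (cCC a)%:C * (k1 ^+ 2 - k0 * k2) + (cCP a)%:C * (k1 * k2 - k0 * k3) +
  (cPP a)%:C * (k2 ^+ 2 - mu * k0 ^+ 2) +
  (cCS a)%:C * (k2 * k3 - mu * k0 * k1) +
  (cCF a)%:C * (k3 ^+ 2 - mu * k0 * k2) +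
  (cY a - cCF a)%:C * (k3 ^+ 2 - mu * k1 ^+ 2) +
  mu * ((cPF a)%:C * (k1 * k2 - k0 * k3) +
    (cSS a)%:C * (k2 ^+ 2 - mu * k0 ^+ 2) +
    (cSF a)%:C * (k2 * k3 - mu * k0 * k1) +
    mu * (cFF a)%:C * (k1 ^+ 2 - k0 * k2)).

Lemma char_detE (l : R) a y s : fundamental_system s (y s) ->
  char_det l a y s =
  charfun a (s ^+ 2) (sols s 0 l) (sols s 1 l) (sols s 2 l) (sols s 3 l).
Proof.
move=> fs; pose g i j := nth 0 [::
  - (a 1%N)%:C * (j == 0 :> nat)%:R + (a 4%N)%:C * (j == 3)%:R;
  - (a 2%N)%:C * (j == 1)%:R + (a 3%N)%:C * (j == 2)%:R;
  (a 5%N)%:C * sols s (3 + 0 - j) l + (a 8%N)%:C * sols s (3 + 3 - j) l;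
  (a 6%N)%:C * sols s (3 + 1 - j) l + (a 7%N)%:C * sols s (3 + 2 - j) l] i.
transitivity (\det (\matrix_(i < 4, j < 4) g i j)).
  rewrite /char_det; congr (\det _); apply/matrixP => i j; rewrite !mxE.
  rewrite /bc_form /g -!(fundamental_system_at _ _ _ _ _ fs) //.
  have e k : (k < 4)%N -> cderiven k (y s j) 0 = (j == k :> nat)%:R.
    by move=> k4; have [_ /(_ (Ordinal k4))] := fs j.
  by rewrite -[y s j 0]/(cderiven 0 (y s j) 0) !e.
rewrite det4_nat /g /= !subn0 !subSS !subn0.
rewrite !(mulr0, mulr1, addr0, add0r, mul0r, subr0, sub0r).
have jk := proj2 (jet_sols s).
have -> : sols s 4 l = s ^+ 2 * sols s 0 l by exact: (jk 0%N).
have -> : sols s 5 l = s ^+ 2 * sols s 1 l by exact: (jk 1%N).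
have -> : sols s 6 l = s ^+ 2 * sols s 2 l by exact: (jk 2%N).
rewrite /charfun /cCC /cCP /cPP /cCS /cY /cCF /cPF /cSS /cSF /cFF.
rewrite /qA0 /qA1 /qA2 /qB0 /qB1 /qB2.
rewrite !(real_complexM, real_complexD, real_complexN).
move: (sols s 0 l) (sols s 1 l) (sols s 2 l) (sols s 3 l) => k0 k1 k2 k3.
move: (s ^+ 2) ((a 1%N)%:C) ((a 2%N)%:C) ((a 3%N)%:C) ((a 4%N)%:C) ((a 5%N)%:C)
  ((a 6%N)%:C) ((a 7%N)%:C) ((a 8%N)%:C) => mu b1 b2 b3 b4 b5 b6 b7 b8.
by ring.
Qed.

End CharacteristicFunction.

(** * Closed forms for s = z^2 with z real *)

Section RealSpectrum.
Context {R : realType}.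
Local Notation C := R[i].

(* [beam 0] = sinh - sin and [beam k] is its k-th derivative. *)
Definition beam (k : nat) (u : R) : R :=
  (expR u - (-1) ^+ k * expR (- u)) / 2 - sin (u + k%:R * (pi / 2)).

Lemma is_derive_beam k (u : R) : is_derive u (1 : R) (beam k) (beam k.+1 u).
Proof.
have d1 : is_derive u (1 : R) (fun v : R => expR (- v)) (- expR (- u)).
  rewrite -mulrN1; apply: (@is_derive1_comp _ expR (fun v => - v)).
have d2 : is_derive u (1 : R) (fun v : R => sin (v + k%:R * (pi / 2)))
    (cos (u + k%:R * (pi / 2)) * 1).
  apply: (@is_derive1_comp _ sin (fun v => v + k%:R * (pi / 2))).
  by rewrite -[X in is_derive _ _ _ X]addr0; apply: is_deriveD.
have -> : beam k = fun v => 2^-1 * (expR v - (-1) ^+ k * expR (- v)) -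
    sin (v + k%:R * (pi / 2)) by apply/funext => v; rewrite /beam mulrC.
apply: is_derive_eq.
rewrite /beam -(natr1 k) (mulrDl _ _ (pi / 2)) mul1r addrA sinDpihalf.
rewrite exprS /GRing.scale /=.
by ring.
Qed.

(** The k-th derivative of y_4 = (sinh zx - sin zx) / (2 z^3). *)
Definition rsols (z : R) (k : nat) (x : R) : R :=
  z ^+ k / (2 * z ^+ 3) * beam k (z * x).

Lemma is_derive_rsols z k x : is_derive x (1 : R) (rsols z k) (rsols z k.+1 x).
Proof.
have d1 : is_derive x (1 : R) (fun v : R => z * v) z.
  by apply: is_derive_eq; rewrite /GRing.scale /= mulr1.
have d2 : is_derive x (1 : R) (beam k \o (fun v : R => z * v))
    (beam k.+1 (z * x) * z).
  by apply: is_derive1_comp; exact: is_derive_beam.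
have -> : rsols z k = fun v =>
    (z ^+ k / (2 * z ^+ 3)) * (beam k \o (fun v : R => z * v)) v.
  by [].
apply: is_derive_eq; rewrite /rsols (exprS z k) /GRing.scale /=.
by ring.
Qed.

Lemma beamD4 k u : beam (k + 4) u = beam k u.
Proof.
rewrite /beam (natrD _ k 4) (mulrDl _ _ (pi / 2)) addrA.
rewrite (_ : 4 * (pi / 2) = pi *+ 2); last first.
  by rewrite -mulr_natl; field.
by rewrite sinD2pi exprD (_ : (-1) ^+ 4 = 1) ?mulr1 // -signr_odd.
Qed.

Lemma jet_rsols z : jet ((z ^+ 2)%:C ^+ 2) (fun k x => (rsols z k x)%:C).
Proof.
split=> k x; first by split=> /=; [exact: is_derive_rsols|exact: is_derive_cst].
rewrite /rsols beamD4 -rmorphXn -real_complexM; congr (_%:C).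
by rewrite exprD; ring.
Qed.

Lemma rsols_at0 z k : z != 0 -> (k < 4)%N -> rsols z k 0 = (k == 3)%:R.
Proof.
move=> z0; rewrite /rsols mulr0 /beam oppr0 expR0 add0r.
case: k => [|[|[|[|]]]] //= _.
- by rewrite mul0r sin0; ring.
- by rewrite mul1r sin_pihalf; field.
- rewrite (_ : 2%:R * (pi / 2) = pi); last by field.
  by rewrite sinpi; ring.
- rewrite (_ : 3%:R * (pi / 2) = pi / 2 + pi); last by field.
  by rewrite sinDpi sin_pihalf; field.
Qed.

Lemma sols_real z k l : z != 0 -> (k < 4)%N ->
  sols (z ^+ 2)%:C k l = (rsols z k l)%:C.
Proof.
move=> z0 k4; set s := (z ^+ 2)%:C.
have h := jet_concomitant _ _ _ l (jet_shift _ _ k (jet_rsols z)) (jet_sols s)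
  (sols_at0 s 0 isT) (sols_at0 s 1 isT) (sols_at0 s 2 isT) (sols_at0 s 3 isT).
rewrite addn0 in h; rewrite h.
rewrite (select_column (s ^+ 2) (fun k => (rsols z k 0)%:C)
  (fun k => sols s k l) k 3 k4) //.
- by rewrite -addnBAC // addnC addnK.
- move=> i i4; rewrite rsols_at0 // eq_sym.
  by case: (3 == i)%N.
- by move=> i; rewrite (proj2 (jet_rsols z)).
- by move=> i; rewrite (proj2 (jet_sols s)).
Qed.

Definition rcharfun (a : nat -> R) (mu k0 k1 k2 k3 : R) : R :=
  cCC a * (k1 ^+ 2 - k0 * k2) + cCP a * (k1 * k2 - k0 * k3) +
  cPP a * (k2 ^+ 2 - mu * k0 ^+ 2) + cCS a * (k2 * k3 - mu * k0 * k1) +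
  cCF a * (k3 ^+ 2 - mu * k0 * k2) +
  (cY a - cCF a) * (k3 ^+ 2 - mu * k1 ^+ 2) +
  mu * (cPF a * (k1 * k2 - k0 * k3) + cSS a * (k2 ^+ 2 - mu * k0 ^+ 2) +
    cSF a * (k2 * k3 - mu * k0 * k1) + mu * cFF a * (k1 ^+ 2 - k0 * k2)).

Lemma charfun_real a mu k0 k1 k2 k3 :
  charfun a mu%:C k0%:C k1%:C k2%:C k3%:C = (rcharfun a mu k0 k1 k2 k3)%:C.
Proof.
rewrite /rcharfun /charfun !expr2.
by rewrite !(real_complexM, real_complexD, real_complexN).
Qed.

(** In every bracket of [charfun] the squares of exp(zl) and exp(-zl) cancel; X Y = 1 and c^2 + s^2
    = 1 do the rest. *)
Lemma char_det_real (l : R) a y z : z != 0 ->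
  fundamental_system (z ^+ 2)%:C (y (z ^+ 2)%:C) ->
  char_det l a y (z ^+ 2)%:C = (@exp_trig_of R l a z / (4 * z ^+ 4))%:C.
Proof.
move=> z0 fs; rewrite char_detE // !sols_real // -rmorphXn charfun_real.
congr (_%:C).
set X := expR (z * l); set Y := expR (- (z * l)).
set c := cos (z * l); set s := sin (z * l).
have XY : X * Y = 1 by rewrite /X /Y -expRD subrr expR0.
have cs : c ^+ 2 + s ^+ 2 = 1 by exact: cos2Dsin2.
have e0 : rsols z 0 l = (X - Y - 2 * s) / (4 * z ^+ 3).
  rewrite /rsols /beam mul0r addr0 -/X -/Y -/s expr0.
  by field.
have e1 : rsols z 1 l = (X + Y - 2 * c) / (4 * z ^+ 2).
  rewrite /rsols /beam mul1r sinDpihalf -/X -/Y -/c !expr1.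
  by field.
have e2 : rsols z 2 l = (X - Y + 2 * s) / (4 * z).
  rewrite /rsols /beam (_ : 2%:R * (pi / 2) = pi); last by field.
  rewrite sinDpi -/X -/Y -/s sqrrN expr1n.
  by field.
have e3 : rsols z 3 l = (X + Y + 2 * c) / 4.
  rewrite /rsols /beam (_ : 3%:R * (pi / 2) = pi / 2 + pi); last by field.
  rewrite addrA sinDpi sinDpihalf -/X -/Y -/c (exprS (-1)) sqrrN expr1n.
  by field.
rewrite e0 e1 e2 e3 /rcharfun -exprM.
set k0 := (X - Y - 2 * s) / _; set k1 := (X + Y - 2 * c) / _.
set k2 := (X - Y + 2 * s) / _; set k3 := (X + Y + 2 * c) / _.
have -> : k1 ^+ 2 - k0 * k2 = (2 - (X + Y) * c) / (4 * z ^+ 4).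
  transitivity ((X * Y + (c ^+ 2 + s ^+ 2) - (X + Y) * c) / (4 * z ^+ 4)).
    by rewrite /k0 /k1 /k2; field.
  by rewrite XY cs.
have -> : k1 * k2 - k0 * k3 = ((X + Y) * s - (X - Y) * c) / (4 * z ^+ 3).
  by rewrite /k0 /k1 /k2 /k3; field.
have -> : k2 ^+ 2 - z ^+ (2 * 2) * k0 ^+ 2 = (X - Y) * s / (2 * z ^+ 2).
  by rewrite /k0 /k2; field.
have -> : k2 * k3 - z ^+ (2 * 2) * k0 * k1 =
    ((X - Y) * c + (X + Y) * s) / (4 * z).
  by rewrite /k0 /k1 /k2 /k3; field.
have -> : k3 ^+ 2 - z ^+ (2 * 2) * k0 * k2 = (2 + (X + Y) * c) / 4.
  transitivity ((X * Y + (c ^+ 2 + s ^+ 2) + (X + Y) * c) / 4).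
    by rewrite /k0 /k2 /k3; field.
  by rewrite XY cs.
have -> : k3 ^+ 2 - z ^+ (2 * 2) * k1 ^+ 2 = (X + Y) * c / 2.
  by rewrite /k1 /k3; field.
rewrite /exp_trig_of /exp_trig !horner_Poly /= -/X -/Y -/c -/s.
by field.
Qed.

End RealSpectrum.

(** * Multiplicity of s = 0, matrix classes and conclusion *)

Section Main.
Context {R : realType}.
Local Notation C := R[i].

Lemma entireD (f g : C -> C) : entire f -> entire g ->
  entire (fun w => f w + g w).
Proof. by move=> hf hg z; exact: (derivableD (hf z) (hg z)). Qed.

Lemma entireB (f g : C -> C) : entire f -> entire g ->
  entire (fun w => f w - g w).
Proof. by move=> hf hg z; exact: (derivableB (hf z) (hg z)). Qed.

Lemma entireM (f g : C -> C) : entire f -> entire g ->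
  entire (fun w => f w * g w).
Proof. by move=> hf hg z; exact: (derivableM (hf z) (hg z)). Qed.

Lemma entire_cst (c : C) : entire (fun=> c).
Proof. by move=> z; exact: derivable_cst. Qed.

Lemma entire_id : entire (fun w : C => w).
Proof. by move=> z; exact: derivable_id. Qed.

Lemma entire_eq_at0 (f g : C -> C) : entire f -> entire g ->
  (forall w, w != 0 -> f w = g w) -> f 0 = g 0.
Proof.
move=> hf hg fg.
have ct (h : C^o -> C^o) : entire h -> (h @ (0 : C^o)^' --> h 0)%classic.
  move=> hh; apply: cvg_within_filter; apply: differentiable_continuous.
  by apply/derivable1_diffP; exact: hh.
have h1 := ct _ hf.
have h2 : ((f : C^o -> C^o) @ (0 : C^o)^' --> (g 0 : C^o))%classic.
  apply: cvg_trans (ct _ hg); apply: near_eq_cvg; near=> w.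
  by rewrite fg //; near: w; exact: nbhs_dnbhs_neq.
exact: (@cvg_unique C^o (@norm_hausdorff _ C^o) _ _ _ _ h1 h2).
Unshelve. all: by end_near.
Qed.

Lemma char_det_at0 (l : R) a y : fundamental_system 0 (y 0) ->
  char_det l a y 0 = (lead0 l a)%:C.
Proof.
move=> fs; rewrite char_detE // !sols_s0 // expr0n.
rewrite -[X in charfun _ X]/(0%:C) charfun_real; congr (_%:C).
rewrite /rcharfun /lead0 !mul0r !subr0 addr0 /= !subn0 !subSS !subn0.
rewrite (_ : 3`! = 6)%N // (_ : 2`! = 2)%N // (_ : 1`! = 1)%N // fact0.
by field.
Qed.

(* What remains of [char_det] after division by s^2 when its constant terms
   vanish. *)
Definition charfun1 (a : nat -> R) (l : R) (w : C) : C :=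
  (cPF a)%:C * (sols w 1 l * sols w 2 l - sols w 0 l * sols w 3 l) +
  (cSS a)%:C * (sols w 2 l * sols w 2 l - w * w * (sols w 0 l * sols w 0 l)) +
  (cSF a)%:C * (sols w 2 l * sols w 3 l - w * w * (sols w 0 l * sols w 1 l)) +
  w * w * (cFF a)%:C * (sols w 1 l * sols w 1 l - sols w 0 l * sols w 2 l).

Lemma entire_charfun1 a l : entire (charfun1 a l).
Proof.
have P i j : entire (fun w => sols w i l * sols w j l).
  exact (entireM _ _ (entire_sols i l) (entire_sols j l)).
have W : entire (fun w : C => w * w) by exact (entireM _ _ entire_id entire_id).
have c (x : R) : entire (fun=> x%:C : C) by exact: entire_cst.
exact (entireD _ _ (entireD _ _ (entireD _ _
  (entireM _ _ (c (cPF a)) (entireB _ _ (P 1 2) (P 0 3)))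
  (entireM _ _ (c (cSS a)) (entireB _ _ (P 2 2) (entireM _ _ W (P 0 0)))))
  (entireM _ _ (c (cSF a)) (entireB _ _ (P 2 3) (entireM _ _ W (P 0 1)))))
  (entireM _ _ (entireM _ _ W (c (cFF a))) (entireB _ _ (P 1 1) (P 0 2)))).
Qed.

Lemma charfun1_at0 a l : charfun1 a l 0 = (lead1 l a)%:C.
Proof.
rewrite /charfun1 !sols_s0 // !mul0r !subr0 addr0.
rewrite -!real_complexM -real_complexN.
rewrite -!(real_complexM, real_complexD).
congr (_%:C); rewrite /lead1 /= !subn0 !subSS !subn0.
rewrite (_ : 3`! = 6)%N // (_ : 2`! = 2)%N // (_ : 1`! = 1)%N // fact0.
by field.
Qed.

Lemma char_det_charfun1 (l : R) a y w : cY a = 0 -> cCF a = 0 -> low_eq0 a ->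
  fundamental_system w (y w) ->
  char_det l a y w = w ^+ 2 * charfun1 a l w.
Proof.
move=> Y0 F0 [C0 P0 S0 Q0] fs; rewrite char_detE // /charfun /charfun1.
by rewrite Y0 F0 C0 P0 S0 Q0 subr0; ring.
Qed.

(** If [lead1 l a] were nonzero, s = 0 would be a root of multiplicity 2 for both problems. The
    cofactor for [ta] agrees with [charfun1 ta l] away from 0, hence by continuity at 0, where the
    latter is [lead1 l ta]. *)
Lemma lead1_neq0 (l : R) (a ta : nat -> R) y :
  (forall s : C, fundamental_system s (y s)) ->
  same_roots_with_mult (char_det l a y) (char_det l ta y) ->
  nondegenerate a -> nondegenerate ta -> cY a = 0 -> cY ta = 0 ->
  low_eq0 a -> low_eq0 ta -> lead1 l ta = 0 -> lead1 l a = 0.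
Proof.
move=> hy heig na nt Y0 Y0' ba bt h; apply/eqP/negP => /negP h'.
have [F0 _] := nondegenerate_monomial _ na Y0.
have [F0' _] := nondegenerate_monomial _ nt Y0'.
have dE w := char_det_charfun1 l _ _ w Y0 F0 ba (hy w).
have dE' w := char_det_charfun1 l _ _ w Y0' F0' bt (hy w).
have [_ /(_ _ 2)[|+ _]] := heig 0; first by rewrite dE expr0n mul0r.
case=> [|g [eg gE g0]].
  exists (charfun1 a l); split; first exact: entire_charfun1.
    by move=> w; rewrite dE subr0.
  by rewrite charfun1_at0; apply: contraNneq h' => -[->].
move/eqP: g0; apply.
rewrite (entire_eq_at0 _ (charfun1 ta l) eg (entire_charfun1 ta l)).
  by rewrite charfun1_at0 h.
move=> w w0; have := gE w; rewrite dE' subr0.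
by move/(mulfI (expf_neq0 2 w0)) => ->.
Qed.

Lemma lin_class_eq (B B' : 'M[R]_(4, 8)) :
  lin_equiv B B' -> lin_class B = lin_class B'.
Proof.
case=> S uS ->; apply/seteqP; split=> [X [T uT ->]|X [T uT ->]].
  exists (T *m invmx S); first by rewrite unitmx_mul uT unitmx_inv.
  by rewrite mulmxA mulmxKV.
by exists (T *m S); rewrite ?unitmx_mul ?uT // mulmxA.
Qed.

Lemma lin_class_same_conditions (a b : nat -> R) : same_conditions a b ->
  lin_class (bc_mx a) = lin_class (bc_mx b).
Proof.
move=> [m1 [m2 [m3 [m4 [[n1 n2 n3 n4] [e1 e4] [e2 e3] [e5 e8] [e6 e7]]]]]].
pose d : 'rV[R]_4 := \row_j nth 0 [:: m1; m2; m3; m4] j.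
apply: lin_class_eq; exists (diag_mx d).
  rewrite unitmxE det_diag unitfE; apply/prodf_neq0 => i _.
  by rewrite mxE; case: i => [[|[|[|[|]]]]].
apply/matrixP => i j; rewrite mul_diag_mx !mxE.
case: i => [[|[|[|[|//]]]] ?] /=; case: j => [[|[|[|[|[|[|[|[|//]]]]]]]] ?] /=;
  by rewrite ?mulr0.
Qed.

Lemma bc_mx_swap_ends (a : nat -> R) : bc_mx (swap_ends a) = bc_mx_star a.
Proof. by []. Qed.

Lemma row_neq0 (a : nat -> R) (i : 'I_4) : \rank (bc_mx a) = 4%N ->
  exists j, bc_mx a i j != 0.
Proof.
move=> rk; have rf : row_free (bc_mx a) by rewrite /row_free rk.
apply/existsP; apply: contraT; rewrite negb_exists => /forallP h.
have : row i (bc_mx a) = 0.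
  by apply/rowP => j; rewrite mxE [RHS]mxE; have := h j; rewrite negbK => /eqP.
rewrite rowE => /eqP; rewrite -(mul0mx _ (bc_mx a)) => /eqP /(row_free_inj rf).
move=> /matrixP /(_ ord0 i); rewrite !mxE !eqxx => /eqP.
by rewrite oner_eq0.
Qed.

Lemma nondegenerate_rank (a : nat -> R) :
  (forall i : nat, (1 <= i <= 8)%N -> 0 <= a i) -> \rank (bc_mx a) = 4%N ->
  nondegenerate a.
Proof.
move=> a0 rk; have P i j : (0 < i <= 8)%N -> (0 < j <= 8)%N ->
    a i != 0 \/ a j != 0 -> 0 < a i + a j.
  move=> hi hj h; rewrite lt_neqAle addr_ge0 ?a0 // andbT eq_sym.
  by rewrite paddr_eq0 ?a0 // negb_and; apply/orP.
split=> //; apply: P => //.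
- have [j] := row_neq0 _ (inord 0) rk; rewrite mxE inordK //.
  by case: j => [[|[|[|[|[|[|[|[|//]]]]]]]] ?] /=; rewrite ?eqxx //; tauto.
- have [j] := row_neq0 _ (inord 1) rk; rewrite mxE inordK //.
  by case: j => [[|[|[|[|[|[|[|[|//]]]]]]]] ?] /=; rewrite ?eqxx //; tauto.
- have [j] := row_neq0 _ (inord 2) rk; rewrite mxE inordK //.
  by case: j => [[|[|[|[|[|[|[|[|//]]]]]]]] ?] /=; rewrite ?eqxx //; tauto.
- have [j] := row_neq0 _ (inord 3) rk; rewrite mxE inordK //.
  by case: j => [[|[|[|[|[|[|[|[|//]]]]]]]] ?] /=; rewrite ?eqxx //; tauto.
Qed.

Lemma same_roots_sym (D D' : C -> C) :
  same_roots_with_mult D D' -> same_roots_with_mult D' D.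
Proof.
move=> h s; have [h1 h2] := h s; split; first by split=> /h1.
by move=> /h1 /h2 h3 m; split=> /h3.
Qed.

(** Restriction of the common roots to s = z^2, z > 0, where the factor 4 z^4 can be cleared. *)
Lemma syzygies_of_same_roots (l : R) (a ta : nat -> R) y : 0 < l ->
  (forall s : C, fundamental_system s (y s)) ->
  same_roots_with_mult (char_det l a y) (char_det l ta y) ->
  nondegenerate a -> syzygies a ta.
Proof.
move=> l0 hy heig na; apply: (syzygies_of_common_zeros l0 _ _ na) => z z0 hz.
have zn : z != 0 by rewrite gt_eqF.
have [+ _] := heig (z ^+ 2)%:C; rewrite !char_det_real // hz mul0r.
case=> /(_ erefl) + _ => -[/eqP].
rewrite mulf_eq0 invr_eq0 mulf_eq0 expf_eq0 /= (negbTE zn) pnatr_eq0 /= orbF.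
by move/eqP.
Qed.

End Main.

Theorem theorem1 (R : realType) (l : R) (hl : 0 < l) (a ta : nat -> R)
  (ha : forall i : nat, (1 <= i <= 8)%N -> 0 <= a i)
  (hta : forall i : nat, (1 <= i <= 8)%N -> 0 <= ta i)
  (hA : \rank (bc_mx a) = 4%N) (htA : \rank (bc_mx ta) = 4%N)
  (y : R[i] -> 'I_4 -> R -> R[i])
  (hy : forall s : R[i], fundamental_system s (y s))
  (heig : same_roots_with_mult (char_det l a y) (char_det l ta y)) :
  lin_class (bc_mx a) = lin_class (bc_mx ta) \/
  lin_class (bc_mx a) = lin_class (bc_mx_star ta).
Proof.
have na := nondegenerate_rank _ ha hA; have nt := nondegenerate_rank _ hta htA.
have heig' := same_roots_sym _ _ heig.
have [||||h|h] := same_conditions_of_syzygies l a ta hl na nt.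
- exact: syzygies_of_same_roots hl hy heig na.
- exact: syzygies_of_same_roots hl hy heig' nt.
- have [h _] := heig 0; rewrite !char_det_at0 // in h.
  by split=> e; have := h; rewrite e => -[];
    [move=> /(_ erefl)|move=> _ /(_ erefl)] => -[].
- move=> Y0 Y0' ba bt; split; apply: lead1_neq0 => //; eassumption.
- by left; exact: lin_class_same_conditions.
- by right; rewrite -bc_mx_swap_ends; exact: lin_class_same_conditions.
Qed.
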